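(* Let $k$ be a number field and let $E_0$ be an elliptic curve over $k$ realized as a plane cubic curve such that the origin $O$ is an inflection point, and assume that its Hessian $He(E_0)$ is a nonsingular cubic curve. The map $\phi$ that associates to $P\in E_0[3]$ the point $\iota'(\eta(P))\in Ca(E_0)[3]$ gives an anti-symplectic isomorphism $\phi:E_0[3]\to Ca(E_0)[3]$.
   Context: Let $F=0$ be the equation of $E_0\subset\mathbf{P}^2$. The Hessian $He(E_0)$ is the curve $\det F''=0$, where $F''$ is the $3\times 3$ matrix of second partial derivatives. For $a=(a_0:a_1:a_2)\in\mathbf{P}^2$, the first polar $P_a(E_0)$ is the conic $a_0F_x+a_1F_y+a_2F_z=0$. For $a\in He(E_0)$ it is a union of two distinct lines; its unique singular point is denoted $\iota(a)$, and $\iota$ is a fixed-point-free involution of $He(E_0)$. The map $\eta:He(E_0)\to(\mathbf{P}^2)^*$ sends $a$ to the line $\overline{a\,\iota(a)}$; its image is the Cayleyan curve $Ca(E_0)$, a nonsingular plane cubic in the dual projective plane isomorphic to $He(E_0)/\langle\iota\rangle$. Identify $He(E_0)$ with its Jacobian using $O$ as origin ($O$ is an inflection point of $He(E_0)$ too). Each $l\in Ca(E_0)$, $l=\overline{a\,\iota(a)}$, is a component of $P_d(E_0)$ with $d=-2a$, and $\iota'(l)$ denotes the other component of $P_d(E_0)$; $\iota'$ is an involution of $Ca(E_0)$. The curve $Ca(E_0)$ is given the origin $O'=\iota'(\eta(O))$, which is an inflection point of it, so $Ca(E_0)[3]$ is its set of inflection points; likewise $E_0[3]=E_0\cap He(E_0)$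 is the set of inflection points of $E_0$. For an elliptic curve $E$, $e_{E,3}$ is the Weil pairing on the $\mathrm{Gal}(\bar k/k)$-module $E[3]\subset E(\bar k)$; an isomorphism of Galois modules $\phi:E_0[3]\to E[3]$ is anti-symplectic if $e_{E,3}(\phi(P),\phi(Q))=e_{E_0,3}(P,Q)^{-1}$ for all $P,Q\in E_0[3]$. *)

(* Defs.v *)
From HB Require Import structures.
From mathcomp Require Import all_boot all_order all_algebra all_field.
From mathcomp Require Import mpoly.

Set Implicit Arguments.
Unset Strict Implicit.
Unset Printing Implicit Defensive.

Import GRing.Theory.
Local Open Scope ring_scope.

(* A point of the projective plane is represented by its unique homogeneous
   coordinate vector whose first nonzero coordinate is 1, so that Leibniz
   equality is equality of points. A line, i.e. a point of the dual plane, is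
   likewise given by the coefficients of its equation. *)
Section ProjectivePlane.
Variable K : fieldType.

Definition lead (v : 'rV[K]_3) : K :=
  if v 0 0 != 0 then v 0 0 else if v 0 1 != 0 then v 0 1 else v 0 2%:R.

Record proj2 : Type := Proj2 { coords :> 'rV[K]_3; _ : lead coords == 1 }.

HB.instance Definition _ := [isSub for coords].
HB.instance Definition _ := [Choice of proj2 by <:].

End ProjectivePlane.

Fact lead_map (k K : fieldType) (f : {rmorphism k -> K}) (p : proj2 k) :
  lead (map_mx f p) == 1.
Proof.
have E j : map_mx f p 0 j = f (p 0 j) by rewrite mxE.
rewrite /lead !E !fmorph_eq0; case: p {E} => v /=; rewrite /lead.
by case: (v 0 0 != 0) => [|]; last case: (v 0 1 != 0); move/eqP->; rewrite rmorph1.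
Qed.

Definition proj2_map (k K : fieldType) (f : {rmorphism k -> K}) (p : proj2 k) :
  proj2 K := Proj2 (lead_map f p).

Section PlaneCurves.
Variable K : fieldType.
Implicit Types (F G A B : {mpoly K[3]}) (a b d l m O P Q R S X : proj2 K).

Definition lin l : {mpoly K[3]} := \sum_i l 0 i *: 'X_i.

Definition on F P : Prop := F.@[P 0] = 0.

Definition singular_point F P : Prop := on F P /\ forall i, on F^`M(i) P.

Definition nonsingular_cubic F : Prop :=
  F \is 3.-homog /\ forall P, ~ singular_point F P.

(* For P a nonsingular point of F = 0, this says that the order of vanishing at
   P of the restriction of G to the curve F = 0 is at least n. It is read off on
   a local parametrization gamma of the curve at P, i.e. an immersed arc with
   gamma(0) = P lying on the curve modulo t^n. When P is not on the curve, only
   n = 0 is possible. *)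
Definition ord_ge F P G (n : nat) : Prop :=
  exists gamma : 'rV[{poly K}]_3,
    [/\ map_mx (coefp 0) gamma = P,
        ~~ (map_mx (coefp 1) gamma <= (P : 'rV[K]_3))%MS,
        'X^n %| mmap polyC (gamma 0) F
      & 'X^n %| mmap polyC (gamma 0) G].

Definition has_ord F P G (n : nat) : Prop :=
  ord_ge F P G n /\ ~ ord_ge F P G n.+1.

(* P + Q + R is the divisor cut out on the curve F = 0 by some line. *)
Definition line_section F P Q R : Prop :=
  exists l, forall X,
    has_ord F X (lin l) ((X == P) + (X == Q) + (X == R))%N.

Definition inflection_point F P : Prop := line_section F P P P.

(* The graph of the group law P + Q = S on the nonsingular cubic F = 0 with
   origin O (chord and tangent construction). *)
Definition add F O P Q S : Prop :=
  exists R, line_section F P Q R /\ line_section F O R S.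

Definition tors3 F O P : Prop := exists R, add F O P P R /\ add F O R P O.

(* The rational function A / B on the cubic F = 0 has divisor 3 (P) - 3 (O). *)
Definition div_3P_3O F O P A B : Prop :=
  (exists n, A \is n.-homog /\ B \is n.-homog) /\
  forall X, on F X -> exists i j : nat,
    [/\ has_ord F X A i, has_ord F X B j
      & (i + 3 * (X == O) = j + 3 * (X == P))%N].

Definition evaluable A B X : Prop := ~ on A X /\ ~ on B X.

Definition ratio A B X : K := A.@[X 0] / B.@[X 0].

(* The graph of the Weil pairing e_3(P, Q) = w on the 3-torsion of the cubic
   F = 0 with origin O: if div f = 3 (P) - 3 (O) and div g = 3 (Q) - 3 (O) then
     e_3(P, Q) = (f(Q + S) / f(S)) / (g(P - S) / g(-S))
   for any S at which all four values are defined and nonzero. The value does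
   not depend on the choice of f, g and S. *)
Definition weil3 F O P Q (w : K) : Prop :=
  exists A B A' B' : {mpoly K[3]}, exists S S' QS PS',
    [/\ div_3P_3O F O P A B /\ div_3P_3O F O Q A' B',
        [/\ add F O S S' O, add F O Q S QS & add F O P S' PS'],
        evaluable A B QS /\ evaluable A B S,
        evaluable A' B' PS' /\ evaluable A' B' S'
      & w = (ratio A B QS / ratio A B S) / (ratio A' B' PS' / ratio A' B' S')].

Definition hessian F : {mpoly K[3]} :=
  \det (\matrix_(i < 3, j < 3) (F^`M(i))^`M(j)).

Definition polar F a : {mpoly K[3]} := \sum_i a 0 i *: F^`M(i).

Definition is_iota F a b : Prop := singular_point (polar F a) b.

Definition is_eta F a l : Prop :=
  on (hessian F) a /\ exists b, [/\ is_iota F a b, on (lin l) a & on (lin l) b].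

Definition cayleyan F l : Prop := exists a, is_eta F a l.

(* With l the line joining a to iota(a) and d = -2a in the Hessian curve with
   origin O, the polar conic of d is the union of the lines l and l'. *)
Definition is_iota' F O l l' : Prop :=
  exists a aa d,
    [/\ is_eta F a l,
        add (hessian F) O a a aa, add (hessian F) O aa d O
      & exists2 c : K, c != 0 & polar F d = c *: (lin l * lin l')].

(* G = 0 is an equation of the Cayleyan, as a nonsingular cubic in the dual
   plane. *)
Definition cayleyan_equation F G : Prop :=
  nonsingular_cubic G /\ forall l, on G l <-> cayleyan F l.

Definition torsion_group_iso F O G O' (phi : proj2 K -> proj2 K) : Prop :=
  [/\ forall P, tors3 F O P -> tors3 G O' (phi P),
      forall P Q, tors3 F O P -> tors3 F O Q -> phi P = phi Q -> P = Q,
      forall R, tors3 G O' R -> exists2 P, tors3 F O P & phi P = R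
    & forall P Q S, tors3 F O P -> tors3 F O Q -> add F O P Q S ->
        add G O' (phi P) (phi Q) (phi S)].

Definition anti_symplectic F O G O' (phi : proj2 K -> proj2 K) : Prop :=
  forall P Q, tors3 F O P -> tors3 F O Q ->
    exists w, weil3 F O P Q w /\ weil3 G O' (phi P) (phi Q) w^-1.

End PlaneCurves.

Definition galois_equivariant (k K : fieldType) (iota : {rmorphism k -> K})
    (D : proj2 K -> Prop) (phi : proj2 K -> proj2 K) : Prop :=
  forall sigma : {rmorphism K -> K},
    bijective sigma -> (forall x, sigma (iota x) = iota x) ->
    forall P, D P -> phi (proj2_map sigma P) = proj2_map sigma (phi P).

(* Main.v *)
Require Import Defs.
From HB Require Import structures.
From mathcomp Require Import all_boot all_order all_algebra all_field.
From mathcomp Require Import mpoly ring.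
From Stdlib Require Import ClassicalEpsilon.

(** Over the algebraically closed field K, a projective transformation brings the
    cubic to a member p (x^3 + y^3 + z^3) + q x y z = 0 of the Hesse pencil, with
    the origin at (0 : 1 : -1) ([hesse_form]). This uses that the Hessian is
    nonsingular, which excludes the Fermat cubic q = 0. All nonsingular members
    of the pencil have the same nine inflection points, and these are indexed by
    (Z/3)^2 with the help of a primitive cube root of unity w in such a way that
    three of them form a line section if and only if their indices add up to 0
    ([line_section_flex], [inflection_hesseP]). The indexing is thus an
    isomorphism onto the 3-torsion ([tors3P], [add_flexP]). The Weil pairing of
    the points of indices (i, j) and (k, l) is w^(i l - j k), whatever p and q
    are ([weil_hesse]).

    The polar conic of an inflection point P is the union of the flexional
    tangent at P and of the harmonic polar of P. The tangent is the line that
    joins P to iota(P), that is eta(P); and since P = -2P on the Hessian, the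
    line iota'(eta(P)) is the harmonic polar ([polar_flex], [is_eta_flex],
    [is_iota'_flex]). In dual coordinates the Cayleyan also belongs to the Hesse
    pencil ([cay_hesse], [cayleyan_hesseP]), and the harmonic polar of the
    inflection point of index (i, j) is the inflection point of index (i, -j) of
    the Cayleyan. So phi is the linear map (i, j) |-> (i, -j) of determinant -1:
    it is an isomorphism and inverts the Weil pairing.

    It remains to return to the given coordinates and to the field k. All the
    notions involved are invariant under projective transformations, provided
    that lines are transformed contragrediently ([add_pull], [weil3_pull],
    [is_iota'_pull], [cayleyan_pull]). The Cayleyan has an equation [cay] which is
    a polynomial covariant of the cubic, hence has coefficients in k ([cay_map],
    [cay_pull]). The harmonic polar is characterized by the factorization of the
    polar conic, so phi commutes with automorphisms over k
    ([harmonic_polar_uniq], [harmonic_polar_map]). *)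

Set Implicit Arguments.
Unset Strict Implicit.
Unset Printing Implicit Defensive.

Import GRing.Theory Defs.
Local Open Scope ring_scope.

(** * Vectors, lines and points of the projective plane *)

Section Vectors.
Variable K : fieldType.
Implicit Types (u v w l n : 'rV[K]_3) (P Q : proj2 K).

Lemma ord3P (i : 'I_3) : [\/ i = 0, i = 1 | i = 2%:R].
Proof.
case: i => [[|[|[|//]]] lti];
  [constructor 1|constructor 2|constructor 3]; exact: val_inj.
Qed.

Lemma sum3 (V : nmodType) (f : 'I_3 -> V) :
  \sum_(i < 3) f i = f 0 + f 1 + f 2%:R.
Proof.
rewrite !big_ord_recl big_ord0 addr0 addrA.
by congr (f _ + f _ + f _); apply: val_inj.
Qed.

Definition vec3 (a b c : K) : 'rV[K]_3 := \row_(i < 3) nth 0 [:: a; b; c] i.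

Lemma vec3E a b c :
  (vec3 a b c 0 0 = a) * (vec3 a b c 0 1 = b) * (vec3 a b c 0 2%:R = c).
Proof. by rewrite !mxE. Qed.

Lemma row3P u v :
  u 0 0 = v 0 0 -> u 0 1 = v 0 1 -> u 0 2%:R = v 0 2%:R -> u = v.
Proof.
by move=> e0 e1 e2; apply/rowP => i; case: (ord3P i) => ->.
Qed.

Definition dot u v : K := \sum_i u 0 i * v 0 i.

Definition cross u v : 'rV[K]_3 :=
  vec3 (u 0 1 * v 0 2%:R - u 0 2%:R * v 0 1)
       (u 0 2%:R * v 0 0 - u 0 0 * v 0 2%:R)
       (u 0 0 * v 0 1 - u 0 1 * v 0 0).

Lemma dotE u v :
  dot u v = u 0 0 * v 0 0 + u 0 1 * v 0 1 + u 0 2%:R * v 0 2%:R.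
Proof. by rewrite /dot sum3. Qed.

Lemma dotC u v : dot u v = dot v u.
Proof. by rewrite !dotE; ring. Qed.

Lemma dotDr l u v : dot l (u + v) = dot l u + dot l v.
Proof. by rewrite !dotE !mxE; ring. Qed.

Lemma dotZr l c u : dot l (c *: u) = c * dot l u.
Proof. by rewrite !dotE !mxE; ring. Qed.

Lemma dotZl l c u : dot (c *: l) u = c * dot l u.
Proof. by rewrite !dotE !mxE; ring. Qed.

Lemma dot_crossl u v : dot (cross u v) u = 0.
Proof. by rewrite dotE /cross !vec3E; ring. Qed.

Lemma dot_crossr u v : dot (cross u v) v = 0.
Proof. by rewrite dotE /cross !vec3E; ring. Qed.

Lemma row3_neq0 v : v != 0 -> exists i, v 0 i != 0.
Proof.
move=> v0; apply/existsP; apply: contraR v0 => /existsPn v0.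
by apply/eqP/rowP => i; rewrite mxE; apply/eqP; move: (v0 i); rewrite negbK.
Qed.

Lemma dot1_exists v : v != 0 -> exists n, dot v n = 1.
Proof.
case/row3_neq0 => i vi; exists (\row_j ((j == i)%:R / v 0 i)).
rewrite /dot (bigD1 i) //= big1 ?addr0 => [|j /negPf ji].
  by rewrite mxE eqxx mul1r divff.
by rewrite mxE ji mul0r mulr0.
Qed.

(** Polynomial consequences of polynomial equations, with explicit
    multipliers, so that what is left is an identity for [ring]. *)
Lemma lin_comb1 (R : pzRingType) (c x y a b : R) :
  x = y -> a - b = c * (x - y) -> a = b.
Proof. by move=> -> /eqP; rewrite subrr mulr0 subr_eq0 => /eqP. Qed.

Lemma lin_comb2 (R : pzRingType) (c d x y z t a b : R) :
  x = y -> z = t -> a - b = c * (x - y) + d * (z - t) -> a = b.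
Proof. by move=> -> -> /eqP; rewrite !subrr !mulr0 addr0 subr_eq0 => /eqP. Qed.

Lemma lin_comb3 (R : pzRingType) (c d e x y z t s r a b : R) :
  x = y -> z = t -> s = r ->
  a - b = c * (x - y) + d * (z - t) + e * (s - r) -> a = b.
Proof.
by move=> -> -> -> /eqP; rewrite !subrr !mulr0 !addr0 subr_eq0 => /eqP.
Qed.

Lemma cross_eq0 u v : u != 0 -> cross u v = 0 -> exists c, v = c *: u.
Proof.
move=> /dot1_exists[n un] uv0; exists (dot v n).
have E j : cross u v 0 j = 0 by rewrite uv0 mxE.
have /= := (E 0, E 1, E 2%:R); rewrite /cross !vec3E => -[[E0 E1] E2].
move: un; rewrite dotE => un; apply: row3P; rewrite !mxE dotE.
- by apply: (lin_comb3 (c := - v 0 0) (d := n 0 2%:R) (e := - n 0 1) un E1 E2); ring.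
- by apply: (lin_comb3 (c := - v 0 1) (d := n 0 0) (e := - n 0 2%:R) un E2 E0); ring.
- by apply: (lin_comb3 (c := - v 0 2%:R) (d := n 0 1) (e := - n 0 0) un E0 E1); ring.
Qed.

Lemma crossZr u c : cross u (c *: u) = 0.
Proof. by apply: row3P; rewrite /cross vec3E !mxE; ring. Qed.

Lemma perp2 u v l : cross u v != 0 -> dot l u = 0 -> dot l v = 0 ->
  exists c, l = c *: cross u v.
Proof.
move=> uv lu lv; apply: cross_eq0 => //.
move: lu lv; rewrite !dotE => lu lv.
apply: row3P; rewrite /cross !vec3E mxE.
- by apply: (lin_comb2 (c := v 0 0) (d := - u 0 0) lu lv); ring.
- by apply: (lin_comb2 (c := v 0 1) (d := - u 0 1) lu lv); ring.
- by apply: (lin_comb2 (c := v 0 2%:R) (d := - u 0 2%:R) lu lv); ring.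
Qed.

(** Two independent vectors of a plane span it: the coefficients are those of
    Cramer's rule with a third vector on which the equation takes value 1. *)
Lemma span2 u v l w : cross u v != 0 -> l != 0 ->
  dot l u = 0 -> dot l v = 0 -> dot l w = 0 -> exists a b, w = a *: u + b *: v.
Proof.
move=> uv l0 lu lv lw.
have [c lE] := perp2 uv lu lv.
have c0 : c != 0 by apply: contraNneq l0 => c0; rewrite lE c0 scale0r.
have {lw} : dot (cross u v) w = 0.
  by move: lw; rewrite lE dotZl => /eqP; rewrite mulf_eq0 (negPf c0) => /eqP.
have [n] := dot1_exists uv.
rewrite !dotE /cross !vec3E => un uw.
exists (dot (cross w v) n), (dot (cross u w) n).
rewrite !dotE /cross; apply: row3P; rewrite !mxE /=.
- by apply: (lin_comb2 (c := - w 0 0) (d := n 0 0) un uw); ring.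
- by apply: (lin_comb2 (c := - w 0 1) (d := n 0 1) un uw); ring.
- by apply: (lin_comb2 (c := - w 0 2%:R) (d := n 0 2%:R) un uw); ring.
Qed.

(** If l_i is not 0, the two obvious vectors orthogonal to l that involve
    l_i have cross product l_i l. *)
Lemma line_basis l : l != 0 ->
  exists u v, cross u v != 0 /\ exists2 c, c != 0 & l = c *: cross u v.
Proof.
move=> l0.
have H i u v : l 0 i != 0 -> cross u v = l 0 i *: l ->
    exists u v, cross u v != 0 /\ exists2 c, c != 0 & l = c *: cross u v.
  move=> li E; exists u, v; split; first by rewrite E scaler_eq0 negb_or li.
  by exists (l 0 i)^-1; rewrite ?invr_eq0 // E scalerA mulVf ?scale1r.
case/row3_neq0: (l0) => i li; case: (ord3P i) li => -> li.
- apply: (H 0 (vec3 (- l 0 1) (l 0 0) 0) (vec3 (- l 0 2%:R) 0 (l 0 0))) => //.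
  by apply: row3P; rewrite /cross !vec3E !mxE; ring.
- apply: (H 1 (vec3 (- l 0 1) (l 0 0) 0) (vec3 0 (- l 0 2%:R) (l 0 1))) => //.
  by apply: row3P; rewrite /cross !vec3E !mxE; ring.
- apply: (H 2%:R (vec3 (- l 0 2%:R) 0 (l 0 0)) (vec3 0 (- l 0 2%:R) (l 0 1))) => //.
  by apply: row3P; rewrite /cross !vec3E !mxE; ring.
Qed.

Lemma leadZ c v : c != 0 -> lead (c *: v) = c * lead v.
Proof.
by move=> c0; rewrite /lead !mxE !mulf_eq0 (negPf c0) /=; case: ifP => // _; case: ifP.
Qed.

Lemma lead_neq0 v : v != 0 -> lead v != 0.
Proof.
move=> v0; rewrite /lead; case: ifP => //; case: ifP => // /negbFE/eqP v1 /negbFE/eqP v2.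
by apply: contra v0 => /eqP v3; apply/eqP/row3P; rewrite ?v1 ?v2 ?v3 mxE.
Qed.

Lemma leadP P : lead P = 1. Proof. by case: P => v /= /eqP. Qed.

Lemma proj2_neq0 P : (P : 'rV_3) != 0.
Proof.
apply/eqP => P0; move: (leadP P); rewrite /lead P0 !mxE eqxx => /eqP.
by rewrite eq_sym oner_eq0.
Qed.

Lemma proj2P P Q c : (P : 'rV_3) = c *: (Q : 'rV_3) -> P = Q.
Proof.
move=> E; have c0 : c != 0.
  by apply: contraNneq (proj2_neq0 P) => c0; rewrite E c0 scale0r.
by apply: val_inj => /=; rewrite E; move: (leadP P);
  rewrite E leadZ // leadP mulr1 => ->; rewrite scale1r.
Qed.

Fact lead_pt0 : lead (vec3 1 0 0) == 1.
Proof. by rewrite /lead vec3E oner_eq0 eqxx. Qed.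

(** The zero vector, which represents no point, is sent to (1 : 0 : 0). *)
Definition nrm v : proj2 K := insubd (Proj2 lead_pt0) ((lead v)^-1 *: v).

Lemma nrmP v : v != 0 -> exists2 c, c != 0 & v = c *: (nrm v : 'rV_3).
Proof.
move=> v0; have l0 := lead_neq0 v0; exists (lead v) => //.
rewrite [X in _ = _ *: X]val_insubd leadZ ?invr_eq0 // mulVf // eqxx.
by rewrite scalerA divff // scale1r.
Qed.

Lemma nrm_eq v P c : c != 0 -> v = c *: (P : 'rV_3) -> nrm v = P.
Proof.
move=> c0 E; have v0 : v != 0 by rewrite E scaler_eq0 negb_or c0 proj2_neq0.
have [d d0 E'] := nrmP v0.
apply: (@proj2P _ _ (d^-1 * c)).
by rewrite -scalerA -E {2}E' scalerA mulVf ?scale1r.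
Qed.

Lemma nrmK P : nrm P = P.
Proof. by apply: (nrm_eq (oner_neq0 K)); rewrite scale1r. Qed.

Lemma nrmZ c v : c != 0 -> v != 0 -> nrm (c *: v) = nrm v.
Proof.
move=> c0 /nrmP[d d0 E]; apply: (@nrm_eq _ _ (c * d)); first by rewrite mulf_neq0.
by rewrite {1}E scalerA.
Qed.

Lemma proj2_cross P Q : P <> Q -> cross P Q != 0.
Proof.
move=> PQ; apply/eqP => /(cross_eq0 (proj2_neq0 P))[c /proj2P E]; exact/PQ.
Qed.

End Vectors.

(** Coordinates are indexed modulo 3, so that what is invariant under cyclic
    permutation of the coordinates is proved once, at an arbitrary index i. *)
Lemma cycE (i : 'I_3) : ((i + 1 == i) = false) * ((i == i + 1) = false)
  * ((i + 2%:R == i) = false) * ((i == i + 2%:R) = false)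
  * ((i + 2%:R == i + 1) = false) * ((i + 1 == i + 2%:R) = false)
  * (i + 1 + 1 = i + 2%:R) * (i + 1 + 2%:R = i) * (i + 2%:R + 1 = i)
  * (i + 2%:R + 2%:R = i + 1).
Proof. by case: (ord3P i) => ->; do !split; try exact: val_inj. Qed.

Lemma ord3_cycP (i m : 'I_3) : [\/ m = i, m = i + 1 | m = i + 2%:R].
Proof.
by case: (ord3P i) => ->; case: (ord3P m) => ->;
  first [by constructor 1; apply: val_inj|by constructor 2; apply: val_inj
        |by constructor 3; apply: val_inj].
Qed.

Lemma sum3_cyc (V : nmodType) (f : 'I_3 -> V) i :
  \sum_(m < 3) f m = f i + f (i + 1) + f (i + 2%:R).
Proof.
rewrite (reindex_inj (addrI i)) sum3 addr0.
by [].
Qed.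

Lemma prod3 (V : comNzRingType) (f : 'I_3 -> V) :
  \prod_(m < 3) f m = f 0 * f 1 * f 2%:R.
Proof.
rewrite !big_ord_recl big_ord0 mulr1 mulrA.
by congr (f _ * f _ * f _); apply: val_inj.
Qed.

Lemma prod3_cyc (V : comNzRingType) (f : 'I_3 -> V) i :
  \prod_(m < 3) f m = f i * f (i + 1) * f (i + 2%:R).
Proof.
rewrite (reindex_inj (addrI i)) prod3 addr0.
by [].
Qed.

Lemma det3 (R : comNzRingType) (M : 'M[R]_3) : \det M =
  M 0 0 * (M 1 1 * M 2%:R 2%:R - M 1 2%:R * M 2%:R 1)
  - M 0 1 * (M 1 0 * M 2%:R 2%:R - M 1 2%:R * M 2%:R 0)
  + M 0 2%:R * (M 1 0 * M 2%:R 1 - M 1 1 * M 2%:R 0).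
Proof.
rewrite (expand_det_row _ 0) sum3 /cofactor.
rewrite !(expand_det_row _ (0 : 'I_2)) !big_ord_recl !big_ord0 /cofactor.
rewrite !det_mx11 !mxE.
pose f (a b : nat) := M (inord a) (inord b).
have ME i j : M i j = f i j by rewrite /f !inord_val.
rewrite !ME /= /bump /= !add0n ?addn0 /=.
by ring.
Qed.

Lemma mulmx3 (R : pzRingType) m n (M : 'M[R]_(m, 3)) (N : 'M[R]_(3, n)) i j :
  (M *m N) i j = M i 0 * N 0 j + M i 1 * N 1 j + M i 2%:R * N 2%:R j.
Proof. by rewrite mxE sum3. Qed.

Lemma I3E : ((0 : 'I_3) + 1 = 1) * ((0 : 'I_3) + 2%:R = 2%:R) * ((1 : 'I_3) + 1 = 2%:R)
  * ((1 : 'I_3) + 2%:R = 0) * ((2%:R : 'I_3) + 1 = 0) * ((2%:R : 'I_3) + 2%:R = 1).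
Proof. by do !split; apply: val_inj. Qed.

(** * Polynomials and linear substitutions *)

(** Polynomials form the algebra generated by constants and variables, so
    two algebra morphisms or two derivations that agree there are equal. *)
Lemma mpoly_alg_ind (R : comNzRingType) (n : nat) (P : {mpoly R[n]} -> Prop) :
  (forall c, P c%:MP) -> (forall i, P 'X_i) ->
  (forall p q, P p -> P q -> P (p + q)) ->
  (forall p q, P p -> P q -> P (p * q)) -> forall p, P p.
Proof.
move=> PC PX PD PM p; rewrite (mpolyE p).
apply: big_ind => [|x y|m _]; [by rewrite -mpolyC0|exact: PD|].
rewrite -mul_mpolyC; apply: (PM _ _) => //; rewrite mpolyXE_id.
apply: big_ind => [|x y|i _]; [by rewrite -mpolyC1|exact: PM|].
by elim: (m i) => [|k IH]; [rewrite expr0 -mpolyC1 | rewrite exprS; apply: (PM _ _)].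
Qed.

Lemma mmap_ext (R S : comNzRingType) (n : nat) (f : R -> S) (h h' : 'I_n -> S) p :
  h =1 h' -> mmap f h p = mmap f h' p.
Proof. by move=> E; apply: eq_bigr => m _; rewrite (mmap1_eq _ E). Qed.

Lemma mmap_homog (R S : comNzRingType) (n : nat) (f : {rmorphism R -> S})
    (h : 'I_n -> S) (c : S) (d : nat) (p : {mpoly R[n]}) : p \is d.-homog ->
  mmap f (fun i => c * h i) p = c ^+ d * mmap f h p.
Proof.
move=> /dhomogP hp; rewrite /mmap mulr_sumr; apply: eq_big_seq => m /hp dm.
rewrite mulrCA; congr (_ * _); rewrite /mmap1 -dm /= mdegE.
under eq_bigr do rewrite exprMn.
by rewrite big_split -prodrXr.
Qed.

Lemma mderivXU (R : comNzRingType) n (i j : 'I_n) :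
  'X_i^`M(j) = (i == j)%:R%:MP :> {mpoly R[n]}.
Proof.
rewrite mderivX mnm1E; case: eqP => [->|_]; last by rewrite scale0r mpolyC0.
by rewrite scale1r -[X in (X - _)%MM]add0m addmK mpolyX0 mpolyC1.
Qed.

Lemma mderiv_sum (R : nzRingType) n (I : finType) (f : I -> {mpoly R[n]}) k :
  (\sum_i f i)^`M(k) = \sum_i (f i)^`M(k).
Proof. exact: raddf_sum. Qed.

Lemma map_mpoly_mderiv (R S : nzRingType) n (f : {additive R -> S}) (p : {mpoly R[n]}) i :
  (map_mpoly f p)^`M(i) = map_mpoly f p^`M(i).
Proof.
apply/mpolyP => m; rewrite mcoeff_mderiv !mcoeff_map_mpoly mcoeff_mderiv.
by rewrite raddfMn.
Qed.

Lemma meval_map_mpoly (R S : comNzRingType) n (f : {rmorphism R -> S})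
    (h : 'I_n -> R) (p : {mpoly R[n]}) :
  (map_mpoly f p).@[f \o h] = f p.@[h].
Proof.
elim/mpoly_alg_ind: p => [c|i|p q IHp IHq|p q IHp IHq].
- by rewrite map_mpolyC !mevalC.
- by rewrite map_mpolyX !mevalXU.
- by rewrite raddfD !mevalD IHp IHq rmorphD.
- by rewrite rmorphM !mevalM IHp IHq rmorphM.
Qed.

Lemma mmap_rmorph (R S T : comNzRingType) (n : nat) (f : {rmorphism R -> S})
    (k : {rmorphism S -> T}) (h : 'I_n -> S) p :
  k (mmap f h p) = mmap (k \o f) (k \o h) p.
Proof.
rewrite raddf_sum; apply: eq_bigr => m _; rewrite /= rmorphM rmorph_prod /=.
by congr (_ * _); apply: eq_bigr => i _; rewrite rmorphXn.
Qed.

Section Pull.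
Variable K : fieldType.
Implicit Types (A B : 'M[K]_3) (F G : {mpoly K[3]}) (v w : 'rV[K]_3).

(** The form v |-> F(vA) on row vectors. *)
Definition pull A F : {mpoly K[3]} :=
  F \mPo [tuple \sum_i A i j *: 'X_i | j < 3].

Lemma pullC A c : pull A c%:MP = c%:MP. Proof. exact: comp_mpolyC. Qed.

Lemma pullX A j : pull A 'X_j = \sum_i A i j *: 'X_i.
Proof. by rewrite /pull /comp_mpoly mmapX mmap1U tnth_mktuple. Qed.

Lemma pullD A F G : pull A (F + G) = pull A F + pull A G.
Proof. exact: raddfD. Qed.

Lemma pullM A F G : pull A (F * G) = pull A F * pull A G.
Proof. exact: rmorphM. Qed.

Lemma pullZ A c F : pull A (c *: F) = c *: pull A F.
Proof. exact: comp_mpolyZ. Qed.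

Lemma pull_sum A (I : finType) (f : I -> {mpoly K[3]}) :
  pull A (\sum_i f i) = \sum_i pull A (f i).
Proof. exact: raddf_sum. Qed.

HB.instance Definition _ A := GRing.RMorphism.copy (pull A)
  (comp_mpoly [tuple \sum_i A i j *: 'X_i | j < 3]).

Lemma mmap_pull (S : comNzRingType) (f : {rmorphism K -> S}) (h : 'I_3 -> S) A F :
  mmap f h (pull A F) = mmap f (fun j => \sum_i f (A i j) * h i) F.
Proof.
elim/mpoly_alg_ind: F => [c|j|p q IHp IHq|p q IHp IHq].
- by rewrite pullC !mmapC.
- rewrite pullX mmapX mmap1U raddf_sum /=; apply: eq_bigr => i _.
  by rewrite mmapZ mmapX mmap1U.
- by rewrite pullD !mmapD IHp IHq.
- by rewrite pullM !rmorphM /= IHp IHq.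
Qed.

Lemma meval_pull A F v : (pull A F).@[v 0] = F.@[(v *m A) 0].
Proof.
rewrite /meval (mmap_pull idfun); apply: mmap_ext => j /=.
by rewrite mxE; apply: eq_bigr => i _; rewrite mulrC.
Qed.

Lemma meval_homog d F c v : F \is d.-homog ->
  F.@[(c *: v) 0] = c ^+ d * F.@[v 0].
Proof.
move=> hF; rewrite /meval -(mmap_homog idfun _ _ hF); apply: mmap_ext => i.
by rewrite mxE.
Qed.

Lemma pull_pull A B F : pull A (pull B F) = pull (A *m B) F.
Proof.
elim/mpoly_alg_ind: F => [c|j|p q IHp IHq|p q IHp IHq].
- by rewrite !pullC.
- rewrite !pullX pull_sum.
  under eq_bigr do rewrite pullZ pullX scaler_sumr.
  rewrite exchange_big; apply: eq_bigr => i _.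
  under eq_bigr do rewrite scalerA.
  rewrite -scaler_suml mxE; congr (_ *: _).
  by apply: eq_bigr => k _; rewrite mulrC.
- by rewrite !pullD IHp IHq.
- by rewrite !pullM IHp IHq.
Qed.

Lemma pull1 F : pull 1%:M F = F.
Proof.
elim/mpoly_alg_ind: F => [c|j|p q IHp IHq|p q IHp IHq].
- by rewrite pullC.
- rewrite pullX (bigD1 j) //= big1 => [|i /negPf ij].
    by rewrite mxE eqxx scale1r addr0.
  by rewrite mxE ij scale0r.
- by rewrite !pullD IHp IHq.
- by rewrite !pullM IHp IHq.
Qed.

Lemma pull_invmx A F : A \in unitmx -> pull (invmx A) (pull A F) = F.
Proof. by move=> uA; rewrite pull_pull mulVmx // pull1. Qed.

Lemma pull_homog A d F : F \is d.-homog -> pull A F \is d.-homog.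
Proof.
have hX j : \sum_i A i j *: 'X_i \is 1.-homog for mdeg.
  by apply: rpred_sum => i _; apply: rpredZ; rewrite dhomogX /= mdeg1.
move=> /dhomogP hF; rewrite (mpolyE F) /pull raddf_sum /= big_seq.
apply: rpred_sum => m /hF <-; rewrite comp_mpolyZ; apply: rpredZ.
rewrite comp_mpolyX /= mdegE; elim/big_rec2: _ => [|i d' p _ IH].
  exact: dhomog1.
apply: dhomogM => //; rewrite tnth_mktuple -[X in X.-homog]mul1n.
exact: dhomogMn.
Qed.

(** The chain rule: both sides are derivations over [pull A]. *)
Lemma mderiv_pull A F i :
  (pull A F)^`M(i) = \sum_j A i j *: pull A F^`M(j).
Proof.
elim/mpoly_alg_ind: F => [c|k|p q IHp IHq|p q IHp IHq].
- rewrite pullC mderivC big1 // => j _.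
  by rewrite mderivC -[0]/(0%:MP) pullC scaler0.
- rewrite pullX raddf_sum /= [RHS](bigD1 k) //=.
  rewrite [X in _ = _ + X]big1 ?addr0 => [|j /negPf jk].
    rewrite mderivXU eqxx pullC (bigD1 i) //= [X in _ + X]big1 ?addr0 => [|j /negPf ji].
      by rewrite mderivZ mderivXU eqxx.
    by rewrite mderivZ mderivXU ji mpolyC0 scaler0.
  by rewrite mderivXU eq_sym jk pullC mpolyC0 scaler0.
- rewrite pullD mderivD IHp IHq -big_split; apply: eq_bigr => j _.
  by rewrite mderivD pullD scalerDr.
- rewrite pullM mderivM IHp IHq mulr_suml mulr_sumr -big_split.
  apply: eq_bigr => j _.
  by rewrite mderivM pullD !pullM scalerDr scalerAl scalerAr.
Qed.

End Pull.

(** * Invariance under projective transformations *)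

Section Transport.
Variable K : fieldType.
Implicit Types (A B : 'M[K]_3) (F G : {mpoly K[3]}) (u v w : 'rV[K]_3).
Implicit Types (P Q R X l : proj2 K).

Definition linv w : {mpoly K[3]} := \sum_i w 0 i *: 'X_i.

Lemma meval_linv w v : (linv w).@[v 0] = dot w v.
Proof. by rewrite raddf_sum; apply: eq_bigr => i _; rewrite /= mevalZ mevalXU. Qed.

Lemma linvZ c w : linv (c *: w) = c *: linv w.
Proof. by rewrite scaler_sumr; apply: eq_bigr => i _; rewrite mxE scalerA. Qed.

Lemma linv_homog w : linv w \is 1.-homog.
Proof. by apply: rpred_sum => i _; apply: rpredZ; rewrite dhomogX /= mdeg1. Qed.

Lemma pull_linv A w : pull A (linv w) = linv (w *m A^T).
Proof.
rewrite pull_sum; under eq_bigr do rewrite pullZ pullX scaler_sumr.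
rewrite exchange_big; apply: eq_bigr => i _; under eq_bigr do rewrite scalerA.
by rewrite -scaler_suml mxE; congr (_ *: _); apply: eq_bigr => j _; rewrite mxE.
Qed.

Lemma mderiv_homog d F i : F \is d.+1.-homog -> F^`M(i) \is d.-homog.
Proof.
move=> /dhomogP hF; apply/dhomogP => m; rewrite mcoeff_msupp mcoeff_mderiv => nz.
have /hF : (m + U_(i))%MM \in msupp F.
  by rewrite mcoeff_msupp; apply: contraNneq nz => ->; rewrite mul0rn.
by rewrite /= mdegD mdeg1 addn1 => -[].
Qed.

Lemma polar_homog d F P : F \is d.+1.-homog -> polar F P \is d.-homog.
Proof.
by move=> hF; apply: rpred_sum => i _; apply: rpredZ; apply: mderiv_homog.
Qed.

Definition act A P : proj2 K := nrm (P *m A).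

Lemma mulmx_unit_neq0 A v : A \in unitmx -> v != 0 -> v *m A != 0.
Proof. by move=> uA; apply: contra => /eqP E; rewrite -(mulmxK uA v) E mul0mx. Qed.

Lemma actP A P : A \in unitmx ->
  exists2 c, c != 0 & P *m A = c *: (act A P : 'rV_3).
Proof. by move=> uA; apply: nrmP; exact: mulmx_unit_neq0 uA (proj2_neq0 P). Qed.

Lemma act_nrm A v : A \in unitmx -> v != 0 -> act A (nrm v) = nrm (v *m A).
Proof.
move=> uA v0; have [c c0 E] := nrmP v0.
by rewrite {2}E -scalemxAl nrmZ //; exact: mulmx_unit_neq0 uA (proj2_neq0 _).
Qed.

Lemma act_comp A B P : A \in unitmx -> B \in unitmx ->
  act B (act A P) = act (A *m B) P.
Proof.
move=> uA uB; rewrite [act A P]/act act_nrm -?mulmxA //.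
exact: (mulmx_unit_neq0 uA (proj2_neq0 P)).
Qed.

Lemma act1 P : act 1%:M P = P. Proof. by rewrite /act mulmx1 nrmK. Qed.

Lemma actK A : A \in unitmx -> cancel (act A) (act (invmx A)).
Proof. by move=> uA P; rewrite act_comp ?unitmx_inv // mulmxV // act1. Qed.

Lemma actKV A : A \in unitmx -> cancel (act (invmx A)) (act A).
Proof. by move=> uA P; rewrite act_comp ?unitmx_inv // mulVmx // act1. Qed.

Lemma act_inj A : A \in unitmx -> injective (act A).
Proof. by move=> uA; apply: can_inj (actK uA). Qed.

Lemma act_eq A P Q : A \in unitmx -> (act A P == act A Q) = (P == Q).
Proof. by move=> uA; apply: (inj_eq (act_inj uA)). Qed.

(** The induced action on line coordinates, see [on_lin_act]. *)
Definition dual_mx A := (invmx A)^T.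

Lemma dual_unit A : A \in unitmx -> dual_mx A \in unitmx.
Proof. by move=> uA; rewrite unitmx_tr unitmx_inv. Qed.

Lemma lin_act A l : A \in unitmx -> exists2 c, c != 0 &
  lin l = c *: pull A (lin (act (dual_mx A) l)).
Proof.
move=> uA; have [c c0 E] := actP l (dual_unit uA); exists c => //.
rewrite -[lin (act _ _)]/(linv _) pull_linv -linvZ scalemxAl -E.
by rewrite /dual_mx -mulmxA -trmx_mul mulmxV // trmx1 mulmx1.
Qed.

Lemma onZ c F P : c != 0 -> on (c *: F) P <-> on F P.
Proof.
move=> c0; rewrite /on mevalZ; split=> [/eqP|->]; last by rewrite mulr0.
by rewrite mulf_eq0 (negPf c0) => /eqP.
Qed.

Lemma ord_geZr c F P G n : c != 0 -> ord_ge F P (c *: G) n <-> ord_ge F P G n.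
Proof.
have H a G' : ord_ge F P G' n -> ord_ge F P (a *: G') n.
  by case=> g [g0 g1 gF gG]; exists g; split=> //; rewrite mmapZ; apply: dvdp_mull.
by move=> c0; split=> [/(H c^-1)|/H//]; rewrite scalerA mulVf // scale1r.
Qed.

Lemma ord_geZl c F P G n : c != 0 -> ord_ge (c *: F) P G n <-> ord_ge F P G n.
Proof.
have H a F' : ord_ge F' P G n -> ord_ge (a *: F') P G n.
  by case=> g [g0 g1 gF gG]; exists g; split=> //; rewrite mmapZ; apply: dvdp_mull.
by move=> c0; split=> [/(H c^-1)|/H//]; rewrite scalerA mulVf // scale1r.
Qed.

Lemma has_ordZr c F P G n : c != 0 -> has_ord F P (c *: G) n <-> has_ord F P G n.
Proof. by move=> c0; rewrite /has_ord !ord_geZr. Qed.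

Lemma has_ordZl c F P G n : c != 0 -> has_ord (c *: F) P G n <-> has_ord F P G n.
Proof. by move=> c0; rewrite /has_ord !ord_geZl. Qed.

Lemma line_sectionZ c F P Q R : c != 0 ->
  line_section (c *: F) P Q R <-> line_section F P Q R.
Proof. by move=> c0; split=> -[l hl]; exists l => X; apply/(has_ordZl _ _ _ _ c0). Qed.

Lemma addZ c F O P Q R : c != 0 -> add (c *: F) O P Q R <-> add F O P Q R.
Proof.
by move=> c0; split=> -[S [h1 h2]]; exists S; split;
  apply/(line_sectionZ _ _ _ _ c0).
Qed.

Lemma singular_pointZ c F P : c != 0 -> singular_point (c *: F) P <-> singular_point F P.
Proof.
move=> c0; split=> -[h h']; split; try exact/(onZ _ _ c0);
  by move=> i; move: (h' i); rewrite mderivZ onZ.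
Qed.

Section PullbackOneWay.
Variable A : 'M[K]_3.
Hypothesis uA : A \in unitmx.

Lemma on_pull d F P : F \is d.-homog -> on (pull A F) P <-> on F (act A P).
Proof.
move=> hF; rewrite /on meval_pull; have [c c0 ->] := actP P uA.
rewrite (meval_homog _ _ hF); split=> [/eqP|->]; last by rewrite mulr0.
by rewrite mulf_eq0 expf_eq0 (negPf c0) andbF => /eqP.
Qed.

(** The matrix A carries an arc at P to an arc at its image. The homogeneous
    coordinates of the image must be normalized, which multiplies the values
    of homogeneous polynomials by nonzero constants. *)
Lemma ord_ge_pull_sub d e F G P n : F \is d.-homog -> G \is e.-homog ->
  ord_ge (pull A F) P (pull A G) n -> ord_ge F (act A P) G n.
Proof.
move=> hF hG [g [g0 g1 gF gG]]; have [c c0 E] := actP P uA.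
have c0' : c^-1 != 0 by rewrite invr_eq0.
have cf k : map_mx (coefp k) (c^-1%:P *: (g *m map_mx polyC A)) =
    c^-1 *: (map_mx (coefp k) g *m A).
  apply/rowP => j; rewrite !mxE [LHS]coefCM; congr (_ * _).
  by rewrite coef_sum; apply: eq_bigr => i _; rewrite !mxE coefMC.
have mm m H : H \is m.-homog ->
    mmap polyC ((c^-1%:P *: (g *m map_mx polyC A)) 0) H =
    c^-1%:P ^+ m * mmap polyC (g 0) (pull A H).
  move=> hH; rewrite (mmap_pull polyC) -(mmap_homog polyC _ _ hH).
  apply: mmap_ext => j; rewrite !mxE; congr (_ * _).
  by apply: eq_bigr => i _; rewrite !mxE mulrC.
exists (c^-1%:P *: (g *m map_mx polyC A)); split.
- by rewrite cf g0 E scalerA mulVf // scale1r.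
- rewrite cf; apply: contra g1; rewrite !(eqmx_scale _ c0').
  have <- : (map_mx (coefp 1) g *m A <= P *m A)%MS =
      (map_mx (coefp 1) g <= (P : 'rV_3))%MS by rewrite submxMfree ?row_free_unit.
  by rewrite E; move: (eqmx_scale (act A P : 'rV_3) c0) => Q; rewrite Q.
- by rewrite (mm _ _ hF); apply: dvdp_mull.
- by rewrite (mm _ _ hG); apply: dvdp_mull.
Qed.

End PullbackOneWay.

Section Pullback.
Variable A : 'M[K]_3.
Hypothesis uA : A \in unitmx.
Let uA' : invmx A \in unitmx. Proof. by rewrite unitmx_inv. Qed.
Let uAd := dual_unit uA.

Lemma ord_ge_pull d e F G P n : F \is d.-homog -> G \is e.-homog ->
  ord_ge (pull A F) P (pull A G) n <-> ord_ge F (act A P) G n.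
Proof.
move=> hF hG; split; first exact: (ord_ge_pull_sub uA hF hG).
move=> h; rewrite -[P](actK uA).
by apply: (ord_ge_pull_sub uA' (pull_homog A hF) (pull_homog A hG)); rewrite !pull_invmx.
Qed.

Lemma has_ord_pull d e F G P n : F \is d.-homog -> G \is e.-homog ->
  has_ord (pull A F) P (pull A G) n <-> has_ord F (act A P) G n.
Proof. by move=> hF hG; rewrite /has_ord !(ord_ge_pull _ _ hF hG). Qed.

Lemma has_ord_lin d F P l n : F \is d.-homog ->
  has_ord (pull A F) P (lin l) n <-> has_ord F (act A P) (lin (act (dual_mx A) l)) n.
Proof.
move=> hF; have [c c0 ->] := lin_act l uA.
by rewrite has_ordZr // (has_ord_pull _ _ hF (linv_homog _)).
Qed.

Lemma line_section_pull d F P Q R : F \is d.-homog ->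
  line_section (pull A F) P Q R <-> line_section F (act A P) (act A Q) (act A R).
Proof.
move=> hF; split=> -[l hl].
  exists (act (dual_mx A) l) => X; rewrite -[X](actKV uA).
  move: (act (invmx A) X) => Y; rewrite !(act_eq _ _ uA).
  by apply/(has_ord_lin _ _ _ hF).
exists (act (invmx (dual_mx A)) l) => X.
apply/(has_ord_lin _ _ _ hF); rewrite (actKV uAd).
by rewrite -(act_eq X P uA) -(act_eq X Q uA) -(act_eq X R uA).
Qed.

Lemma add_pull d F O P Q R : F \is d.-homog ->
  add (pull A F) O P Q R <-> add F (act A O) (act A P) (act A Q) (act A R).
Proof.
move=> hF; split=> -[S [h1 h2]].
  by exists (act A S); split; apply/(line_section_pull _ _ _ hF).
by exists (act (invmx A) S); split; apply/(line_section_pull _ _ _ hF);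
  rewrite (actKV uA).
Qed.

Lemma tors3_pull d F O P : F \is d.-homog ->
  tors3 (pull A F) O P <-> tors3 F (act A O) (act A P).
Proof.
move=> hF; split=> -[S [h1 h2]].
  by exists (act A S); split; apply/(add_pull _ _ _ _ hF).
by exists (act (invmx A) S); split; apply/(add_pull _ _ _ _ hF); rewrite (actKV uA).
Qed.

Lemma singular_point_pull_sub B d F P : B \in unitmx -> F \is d.+1.-homog ->
  singular_point F (act B P) -> singular_point (pull B F) P.
Proof.
move=> uB hF [h h']; split; first exact/(on_pull uB _ hF).
move=> i; rewrite /on mderiv_pull raddf_sum /= big1 // => j _.
have /(on_pull uB P (mderiv_homog j hF)) := h' j.
by rewrite mevalZ /on => ->; rewrite mulr0.
Qed.

Lemma singular_point_pull d F P : F \is d.+1.-homog ->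
  singular_point (pull A F) P <-> singular_point F (act A P).
Proof.
move=> hF; split; last exact: (singular_point_pull_sub uA hF).
move=> h; rewrite -(pull_invmx F uA).
apply: (singular_point_pull_sub uA' (pull_homog A hF)).
by rewrite (actK uA).
Qed.

Lemma nonsingular_pull F : nonsingular_cubic F -> nonsingular_cubic (pull A F).
Proof.
case=> hF h; split; first exact: pull_homog.
by move=> P /(singular_point_pull _ hF) /h.
Qed.

(** The matrices of second derivatives are congruent by A. *)
Lemma hessian_pull F : hessian (pull A F) = (\det A ^+ 2) *: pull A (hessian F).
Proof.
have -> : hessian (pull A F) = \det (map_mx (@mpolyC 3 K) A *m
   map_mx (pull A) (\matrix_(i < 3, j < 3) (F^`M(i))^`M(j)) *m
   (map_mx (@mpolyC 3 K) A)^T).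
  congr (\det _); apply/matrixP => i j; rewrite !mxE mderiv_pull raddf_sum /=.
  under eq_bigr do rewrite mderivZ mderiv_pull scaler_sumr.
  rewrite exchange_big; apply: eq_bigr => k _; rewrite !mxE mulr_suml.
  apply: eq_bigr => m _; rewrite !mxE mul_mpolyC -scalerAl mulrC mul_mpolyC.
  by [].
rewrite !det_mulmx det_tr !det_map_mx -mul_mpolyC mpolyCM /=.
by rewrite -/(hessian F) mulrAC.
Qed.

Lemma polar_pull F P : exists2 c, c != 0 &
  polar (pull A F) P = c *: pull A (polar F (act A P)).
Proof.
have [c c0 E] := actP P uA; exists c => //.
rewrite /polar pull_sum scaler_sumr.
under eq_bigr do rewrite mderiv_pull scaler_sumr.
rewrite exchange_big; apply: eq_bigr => j _; under eq_bigr do rewrite scalerA.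
rewrite -scaler_suml pullZ scalerA; congr (_ *: _).
by transitivity ((P *m A) 0 j); [rewrite mxE|rewrite E mxE].
Qed.

Lemma is_iota_pull F P Q : F \is 3.-homog ->
  is_iota (pull A F) P Q <-> is_iota F (act A P) (act A Q).
Proof.
move=> hF; rewrite /is_iota; have [c c0 ->] := polar_pull F P.
by rewrite singular_pointZ // (singular_point_pull _ (polar_homog _ hF)).
Qed.

Lemma on_lin_act l P : on (lin l) P <-> on (lin (act (dual_mx A) l)) (act A P).
Proof.
have [c c0 ->] := lin_act l uA; rewrite onZ //.
exact: (on_pull uA _ (linv_homog _)).
Qed.

Lemma detA2 : \det A ^+ 2 != 0.
Proof. by move: (uA); rewrite unitmxE unitfE expf_eq0. Qed.

Lemma is_eta_pull d F P l : F \is 3.-homog -> hessian F \is d.-homog ->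
  is_eta (pull A F) P l <-> is_eta F (act A P) (act (dual_mx A) l).
Proof.
move=> hF hH; rewrite /is_eta hessian_pull (onZ _ _ detA2) (on_pull uA _ hH).
split=> -[h [Q [h1 h2 h3]]]; split=> //.
  exists (act A Q); split; [exact: (is_iota_pull _ _ hF).1|
    exact: (on_lin_act _ _).1|exact: (on_lin_act _ _).1].
exists (act (invmx A) Q).
split; [apply: (is_iota_pull _ _ hF).2|exact: (on_lin_act _ _).2|
  apply: (on_lin_act _ _).2]; by rewrite (actKV uA).
Qed.

Lemma cayleyan_pull d F l : F \is 3.-homog -> hessian F \is d.-homog ->
  cayleyan (pull A F) l <-> cayleyan F (act (dual_mx A) l).
Proof.
move=> hF hH; split=> -[P h]; first by exists (act A P); apply: (is_eta_pull _ _ hF hH).1.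
by exists (act (invmx A) P); apply: (is_eta_pull _ _ hF hH).2; rewrite (actKV uA).
Qed.

Lemma polar_lin_pull F P l l' :
  (exists2 c, c != 0 & polar F (act A P) =
     c *: (lin (act (dual_mx A) l) * lin (act (dual_mx A) l'))) ->
  exists2 c, c != 0 & polar (pull A F) P = c *: (lin l * lin l').
Proof.
case=> c c0 E; have [a a0 ->] := polar_pull F P; rewrite E.
have [b b0 ->] := lin_act l uA; have [b' b0' ->] := lin_act l' uA.
exists (a * c / (b * b')); first by rewrite !mulf_neq0 ?invr_neq0 ?mulf_neq0.
rewrite pullZ pullM -scalerAl -scalerAr !scalerA; congr (_ *: _).
by field; rewrite b0 b0'.
Qed.

Lemma is_iota'_pull d F O l l' : F \is 3.-homog -> hessian F \is d.-homog ->
  is_iota' F (act A O) (act (dual_mx A) l) (act (dual_mx A) l') ->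
  is_iota' (pull A F) O l l'.
Proof.
move=> hF hH [a [aa [b [h1 h2 h3 h4]]]].
rewrite -[a](actKV uA) -[aa](actKV uA) -[b](actKV uA) in h1 h2 h3 h4.
exists (act (invmx A) a), (act (invmx A) aa), (act (invmx A) b); split.
- exact/(is_eta_pull _ _ hF hH).
- by rewrite hessian_pull; apply/(addZ _ _ _ _ _ detA2)/(add_pull _ _ _ _ hH).
- by rewrite hessian_pull; apply/(addZ _ _ _ _ _ detA2)/(add_pull _ _ _ _ hH).
- exact: polar_lin_pull.
Qed.

(** The rational functions of the definition are pulled back; being
    quotients of forms of the same degree, they do not see the normalization
    of homogeneous coordinates. *)
Lemma weil3_pull F O P Q (w : K) : F \is 3.-homog ->
  weil3 F (act A O) (act A P) (act A Q) w -> weil3 (pull A F) O P Q w.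
Proof.
move=> hF [a [b [a' [b' [S [S' [QS [PS' [[D D'] [s1 s2 s3] [e1 e2] [e3 e4] ->]]]]]]]]].
rewrite -[S](actKV uA) -[S'](actKV uA) -[QS](actKV uA) -[PS'](actKV uA)
  in s1 s2 s3 e1 e2 e3 e4 *.
have dv P1 a1 b1 : div_3P_3O F (act A O) (act A P1) a1 b1 ->
    div_3P_3O (pull A F) O P1 (pull A a1) (pull A b1).
  case=> -[n [ha hb]] h; split.
    by exists n; split; apply: pull_homog.
  move=> X /(on_pull uA _ hF) /h[i [j [h1 h2 h3]]]; exists i, j.
  split; [exact: (has_ord_pull _ _ hF ha).2|exact: (has_ord_pull _ _ hF hb).2|].
  by rewrite -(act_eq X O uA) -(act_eq X P1 uA).
have rt a1 b1 : (exists n, a1 \is n.-homog /\ b1 \is n.-homog) -> forall X,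
   (evaluable a1 b1 (act A X) -> evaluable (pull A a1) (pull A b1) X) /\
   ratio (pull A a1) (pull A b1) X = ratio a1 b1 (act A X).
  case=> n [ha hb] X; split.
    by case=> h1 h2; split=> [/(on_pull uA X ha)|/(on_pull uA X hb)].
  rewrite /ratio !meval_pull; have [c c0 ->] := actP X uA.
  rewrite (meval_homog _ _ ha) (meval_homog _ _ hb) -mulf_div divff ?mul1r //.
  by rewrite expf_neq0.
have rD := rt _ _ D.1; have rD' := rt _ _ D'.1.
exists (pull A a), (pull A b), (pull A a'), (pull A b').
exists (act (invmx A) S), (act (invmx A) S'), (act (invmx A) QS), (act (invmx A) PS').
split.
- by split; apply: dv.
- by split; apply/(add_pull _ _ _ _ hF).
- by split; apply: (rD _).1.
- by split; apply: (rD' _).1.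
- by rewrite !(rD _).2 !(rD' _).2.
Qed.

End Pullback.
End Transport.

(** * Orders of vanishing along a plane curve *)

Section Order.
Variable K : fieldType.
Implicit Types (F G : {mpoly K[3]}) (u v w l : 'rV[K]_3) (g : 'rV[{poly K}]_3).
Implicit Types (P Q R X : proj2 K).

Lemma dvdXnP n (p : {poly K}) : 'X^n %| p <-> forall i, (i < n)%N -> p`_i = 0.
Proof.
rewrite /dvdp -Pdiv.IdomainMonic.take_poly_modp; split=> [/eqP E i lin|E].
  by have := coef_take_poly n p i; rewrite E lin coef0.
by apply/eqP/polyP => i; rewrite coef_take_poly coef0; case: ifP => // /E.
Qed.

Lemma coef0_mmap g F : (mmap polyC (g 0) F)`_0 = F.@[map_mx (coefp 0) g 0].
Proof.
rewrite -horner_coef0 -[LHS]/(horner_eval 0 _) mmap_rmorph /meval.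
apply: eq_bigr => m _; rewrite /= /horner_eval hornerC; congr (_ * _).
by apply: mmap1_eq => i; rewrite mxE /= horner_coef0.
Qed.

(** The chain rule along an arc. It expresses the coefficients of t and t^2
    in F(g(t)) by the derivatives of F and the coefficients of g. *)
Lemma deriv_mmap g F :
  (mmap polyC (g 0) F)^`() = \sum_i mmap polyC (g 0) F^`M(i) * (g 0 i)^`().
Proof.
elim/mpoly_alg_ind: F => [c|k|p q IHp IHq|p q IHp IHq].
- rewrite mmapC derivC big1 // => i _.
  by rewrite mderivC mmap0 mul0r.
- rewrite mmapX mmap1U [RHS](bigD1 k) //= [X in _ + X]big1 ?addr0 => [|i /negPf ik].
    by rewrite mderivXU eqxx mmapC mul1r.
  by rewrite mderivXU eq_sym ik mmapC raddf0 mul0r.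
- rewrite mmapD derivD IHp IHq -big_split; apply: eq_bigr => i _.
  by rewrite mderivD mmapD mulrDl.
- rewrite rmorphM /= derivM IHp IHq mulr_suml mulr_sumr -big_split.
  apply: eq_bigr => i _; rewrite mderivM mmapD !rmorphM /=.
  by ring.
Qed.

Definition grad F v : 'rV[K]_3 := \row_i F^`M(i).@[v 0].

Lemma coef1_mmap g F :
  (mmap polyC (g 0) F)`_1 =
  dot (grad F (map_mx (coefp 0) g)) (map_mx (coefp 1) g).
Proof.
rewrite -[LHS]mulr1n -coef_deriv deriv_mmap coef_sum; apply: eq_bigr => i _.
by rewrite coef0M coef0_mmap coef_deriv !mxE mulr1n.
Qed.

Lemma coef2_mmap g F :
  (mmap polyC (g 0) F)`_2 *+ 2 =
  \sum_i dot (grad F^`M(i) (map_mx (coefp 0) g)) (map_mx (coefp 1) g) *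
         map_mx (coefp 1) g 0 i
  + dot (grad F (map_mx (coefp 0) g)) (map_mx (coefp 2) g) *+ 2.
Proof.
rewrite -coef_deriv deriv_mmap coef_sum -sumrMnl -big_split.
apply: eq_bigr => i _; rewrite coefM !big_ord_recl big_ord0 /=.
rewrite coef0_mmap coef1_mmap !coef_deriv !mxE mulr1n addr0 -mulrnAr.
by rewrite addrC.
Qed.

Lemma mderiv_linv w i : (linv w)^`M(i) = (w 0 i)%:MP.
Proof.
rewrite raddf_sum (bigD1 i) //= big1 => [|j /negPf ji].
  by rewrite addr0 mderivZ mderivXU eqxx -mul_mpolyC mulr1.
by rewrite mderivZ mderivXU ji mpolyC0 scaler0.
Qed.

Lemma grad_linv w v : grad (linv w) v = w.
Proof. by apply/rowP => i; rewrite mxE mderiv_linv mevalC. Qed.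

Lemma coef_mmap_linv g w k :
  (mmap polyC (g 0) (linv w))`_k = dot w (map_mx (coefp k) g).
Proof.
rewrite raddf_sum coef_sum; apply: eq_bigr => i _.
by rewrite /= mmapZ mmapX mmap1U coefCM mxE.
Qed.

Lemma ord_ge_le F P G m n : (m <= n)%N -> ord_ge F P G n -> ord_ge F P G m.
Proof.
move=> mn [g [g0 g1 gF gG]]; exists g; split=> //;
  exact: dvdp_trans (dvdp_exp2l _ mn) _.
Qed.

Lemma has_ord_uniq F P G m n : has_ord F P G m -> has_ord F P G n -> m = n.
Proof.
move=> [h1 h2] [h3 h4]; apply/eqP; rewrite eqn_leq; apply/andP; split.
  by rewrite leqNgt; apply/negP => nm; apply: h4; apply: ord_ge_le h1.
by rewrite leqNgt; apply/negP => nm; apply: h2; apply: ord_ge_le h3.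
Qed.

Lemma not_subP P v : ~~ (v <= (P : 'rV_3))%MS <-> cross P v != 0.
Proof.
split; apply: contra.
  by move=> /eqP/(cross_eq0 (proj2_neq0 P))[c ->]; apply/sub_rVP; exists c.
by case/sub_rVP => c ->; rewrite crossZr.
Qed.

(** Only the 1-jet of an arc matters for orders at most 1, so a straight line
    in any direction other than that of the point itself will do. *)
Lemma ord_ge1P F P G : ord_ge F P G 1 <-> on F P /\ on G P.
Proof.
split=> [[g [g0 _ /dvdXnP gF /dvdXnP gG]]|[hF hG]].
  by have := (gF 0%N isT, gG 0%N isT); rewrite !coef0_mmap g0 => -[].
have [n Pn] := dot1_exists (proj2_neq0 P).
have [v vP] : exists v, cross P v != 0.
  have [u [v [uv _]]] := line_basis (proj2_neq0 P).
  case: (eqVneq (cross P u) 0) => [/(cross_eq0 (proj2_neq0 P))[a ua]|]; last by exists u.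
  exists v; apply: contra uv => /eqP/(cross_eq0 (proj2_neq0 P))[b vb].
  by rewrite ua vb; apply/eqP/row3P; rewrite /cross !vec3E !mxE; ring.
pose g := map_mx polyC (P : 'rV_3) + 'X *: map_mx polyC v.
have c0 : map_mx (coefp 0) g = P.
  by apply/rowP => i; rewrite !mxE /= coefD coefC coefXM /= addr0.
have c1 : map_mx (coefp 1) g = v.
  by apply/rowP => i; rewrite !mxE /= coefD coefC coefXM /= coefC /= add0r.
exists g; split; rewrite ?c0 ?c1 //; first exact/not_subP.
  by apply/dvdXnP => -[|//] _; rewrite coef0_mmap c0.
by apply/dvdXnP => -[|//] _; rewrite coef0_mmap c0.
Qed.

Lemma ord_ge0 F P G : ord_ge F P G 0.
Proof.
have [g [g0 g1 _ _]] : ord_ge 0 P 0 1 by apply/ord_ge1P; rewrite /on meval0.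
by exists g; split; rewrite // expr0 dvd1p.
Qed.

Lemma has_ord0 F P G : ~ (on F P /\ on G P) -> has_ord F P G 0.
Proof. by move=> h; split; [exact: ord_ge0|move/ord_ge1P]. Qed.

Lemma ord_ge2_linv F P l : ord_ge F P (linv l) 2 ->
  exists v, [/\ cross P v != 0, dot l P = 0, dot l v = 0 & dot (grad F P) v = 0].
Proof.
case=> g [g0 /not_subP g1 /dvdXnP gF /dvdXnP gG].
exists (map_mx (coefp 1) g); split=> //.
- by have := gG 0%N isT; rewrite coef_mmap_linv g0.
- by have := gG 1%N isT; rewrite coef_mmap_linv.
- by have := gF 1%N isT; rewrite coef1_mmap g0.
Qed.

Lemma ord_ge3_linv F P l : ord_ge F P (linv l) 3 ->
  exists v w, [/\ cross P v != 0,
    [/\ dot l P = 0, dot l v = 0 & dot l w = 0],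
    dot (grad F P) v = 0
  & \sum_i dot (grad F^`M(i) P) v * v 0 i + dot (grad F P) w *+ 2 = 0].
Proof.
case=> g [g0 /not_subP g1 /dvdXnP gF /dvdXnP gG].
exists (map_mx (coefp 1) g), (map_mx (coefp 2) g); split=> //.
- have := (gG 0%N isT, gG 1%N isT, gG 2%N isT).
  by rewrite !coef_mmap_linv g0 => -[[-> ->] ->].
- by have := gF 1%N isT; rewrite coef1_mmap g0.
- by have := gF 2%N isT; rewrite -g0 -coef2_mmap => ->; rewrite mul0rn.
Qed.

(** The direction of an arc that meets l to order 2 lies both on l and on
    the tangent of F = 0, so the two lines coincide. *)
Lemma ord_ge2_grad F P l : ord_ge F P (linv l) 2 ->
  dot (grad F P) P = 0 -> grad F P != 0 -> exists c, l = c *: grad F P.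
Proof.
move=> /ord_ge2_linv[v [Pv lP lv gv]] gP g0.
have [a la] := perp2 Pv lP lv; have [b gb] := perp2 Pv gP gv.
have b0 : b != 0 by apply: contraNneq g0 => b0; rewrite gb b0 scale0r.
by exists (a / b); rewrite gb la scalerA mulfVK.
Qed.

(** The third point of a line section is determined by the other two: the line
    is the chord or the tangent, and it then determines the multiplicities. *)
Lemma line_section_uniq F P Q R R' :
  (on F P -> grad F P != 0 /\ dot (grad F P) P = 0) ->
  line_section F P Q R -> line_section F P Q R' -> R = R'.
Proof.
move=> tan [l hl] [l' hl'].
have onl m S (hm : forall X, has_ord F X (lin m) ((X == P) + (X == Q) + (X == S))%N) :
    [/\ on (lin m) P, on (lin m) Q, on F P & P = Q -> ord_ge F P (lin m) 2].
  have ge1 Y : (0 < (Y == P) + (Y == Q) + (Y == S))%N -> on F Y /\ on (lin m) Y.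
    move=> Y0; apply: (ord_ge1P F Y (lin m)).1.
    exact: ord_ge_le Y0 (hm Y).1.
  have [FP lP] : on F P /\ on (lin m) P by apply: ge1; rewrite eqxx.
  have [FQ lQ] : on F Q /\ on (lin m) Q by apply: ge1; rewrite eqxx; case: (Q == P).
  split=> // PQ; apply: ord_ge_le (hm P).1.
  by rewrite eqxx -PQ eqxx.
have [lP lQ FP l2] := onl _ _ hl; have [lP' lQ' _ l2'] := onl _ _ hl'.
have ll' : l = l'.
  case: (eqVneq P Q) => [PQ|/eqP PQ].
    have [g0 gP] := tan FP.
    have [a la] := ord_ge2_grad (l2 PQ) gP g0.
    have [b lb] := ord_ge2_grad (l2' PQ) gP g0.
    have b0 : b != 0.
      by apply: contraNneq (proj2_neq0 l') => b0; rewrite lb b0 scale0r.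
    by apply: (@proj2P _ _ _ (a / b)); rewrite la lb scalerA mulfVK.
  have c0 := proj2_cross PQ.
  rewrite /on !meval_linv in lP lQ lP' lQ'.
  have [a la] := perp2 c0 lP lQ; have [b lb] := perp2 c0 lP' lQ'.
  have b0 : b != 0.
    by apply: contraNneq (proj2_neq0 l') => b0; rewrite lb b0 scale0r.
  by apply: (@proj2P _ _ _ (a / b)); rewrite la lb scalerA mulfVK.
rewrite -{}ll' in hl'; apply/eqP.
have := has_ord_uniq (hl R) (hl' R); rewrite eqxx => /addnI.
by case: (R == R').
Qed.

Lemma singular_pointM F G P : on F P -> on G P -> singular_point (F * G) P.
Proof.
rewrite /on => h h'; split=> [|i]; rewrite /on; first by rewrite mevalM h mul0r.
by rewrite mderivM mevalD !mevalM h h' mul0r mulr0 addr0.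
Qed.

End Order.

(** * The Hesse pencil *)

Section Hesse.
Variable K : fieldType.
Hypothesis char0 : [pchar K] =i pred0.
Implicit Types (F G : {mpoly K[3]}) (u v : 'rV[K]_3).
Implicit Types (P Q R X l : proj2 K) (p q : K).

Lemma natK n : n.+1%:R != 0 :> K.
Proof. by rewrite (pcharf0P K).1. Qed.

Definition hesse p q : {mpoly K[3]} :=
  p%:MP * (\sum_i 'X_i ^+ 3) + q%:MP * \prod_i 'X_i.

Lemma mmap_hesse (S : comNzRingType) (f : {rmorphism K -> S}) (h : 'I_3 -> S) p q i :
  mmap f h (hesse p q) = f p * (h i ^+ 3 + h (i + 1) ^+ 3 + h (i + 2%:R) ^+ 3)
    + f q * (h i * h (i + 1) * h (i + 2%:R)).
Proof.
by rewrite /hesse (sum3_cyc _ i) (prod3_cyc _ i) mmapD !rmorphM !rmorphD !rmorphXn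
  /= !mmapC !mmapX !mmap1U.
Qed.

Lemma meval_hesse p q v i :
  (hesse p q).@[v 0] = p * (v 0 i ^+ 3 + v 0 (i + 1) ^+ 3 + v 0 (i + 2%:R) ^+ 3)
    + q * (v 0 i * v 0 (i + 1) * v 0 (i + 2%:R)).
Proof. exact: (mmap_hesse idfun). Qed.

Lemma hesse_homog p q : hesse p q \is 3.-homog.
Proof.
have h i : ('X_i : {mpoly K[3]}) \is 1.-homog for mdeg by rewrite dhomogX /= mdeg1.
rewrite /hesse !mul_mpolyC; apply: rpredD; apply: rpredZ.
  by apply: rpred_sum => i _; apply: (dhomogMn 3 (h i)).
by rewrite (prod3_cyc _ 0); apply: (dhomogM (dhomogM (h _) (h _)) (h _)).
Qed.

Lemma scale_hesse c p q : c *: hesse p q = hesse (c * p) (c * q).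
Proof. by rewrite /hesse scalerDr !scalerAl -!mul_mpolyC -!mpolyCM. Qed.

Lemma mderiv_hesse p q i :
  (hesse p q)^`M(i) = (3%:R * p)%:MP * 'X_i ^+ 2 + q%:MP * ('X_(i + 1) * 'X_(i + 2%:R)).
Proof.
rewrite /hesse (sum3_cyc _ i) (prod3_cyc _ i) mderivD !mderiv_mulC !mderivD.
rewrite !exprS !expr0 !mulr1 !mderivM !mderivXU.
rewrite !cycE eqxx.
rewrite mpolyC0 mpolyC1 mpolyCM mpolyC_nat.
by ring.
Qed.

(** The product F''(u) v for the cubic F with parameters p and q. It is the
    gradient of F, polarized and multiplied by 2. *)
Definition polarv p q u v : 'rV[K]_3 :=
  \row_i (6%:R * p * (u 0 i * v 0 i) +
          q * (u 0 (i + 1) * v 0 (i + 2%:R) + u 0 (i + 2%:R) * v 0 (i + 1))).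

Lemma polarvC p q u v : polarv p q u v = polarv p q v u.
Proof. by apply/rowP => i; rewrite !mxE; ring. Qed.

Lemma polarvDr p q u v v' : polarv p q u (v + v') = polarv p q u v + polarv p q u v'.
Proof. by apply/rowP => i; rewrite !mxE; ring. Qed.

Lemma polarvZr p q u c v : polarv p q u (c *: v) = c *: polarv p q u v.
Proof. by apply/rowP => i; rewrite !mxE; ring. Qed.

Lemma dot_polarvC p q u v w : dot (polarv p q u v) w = dot (polarv p q u w) v.
Proof.
rewrite /dot !(sum3_cyc _ 0) !mxE !cycE.
by ring.
Qed.

Lemma mderiv2_hesse p q i j : ((hesse p q)^`M(i))^`M(j) =
  if j == i then (6%:R * p)%:MP * 'X_i else
  q%:MP * 'X_(if j == i + 1 then i + 2%:R else i + 1).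
Proof.
rewrite mderiv_hesse mderivD !mderiv_mulC exprS expr1 !mderivM !mderivXU.
rewrite ![_ == j]eq_sym.
by case: (ord3_cycP i j) => ->; rewrite !cycE ?eqxx !mpolyC0 ?mpolyC1
  !mpolyCM !mpolyC_nat; ring.
Qed.

Lemma dot_grad_mderiv p q i u v :
  dot (grad (hesse p q)^`M(i) u) v = polarv p q u v 0 i.
Proof.
rewrite /dot (sum3_cyc _ i) !mxE !mderiv2_hesse !cycE !eqxx.
by rewrite !mevalM !mevalC !mevalXU; ring.
Qed.

Lemma grad_hesse p q v : grad (hesse p q) v =
  \row_i (3%:R * p * v 0 i ^+ 2 + q * (v 0 (i + 1) * v 0 (i + 2%:R))).
Proof.
apply/rowP => i; rewrite !mxE mderiv_hesse.
by rewrite !(mevalD, mevalM, mevalC, mevalXU, rmorphXn).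
Qed.

Lemma polarv_diag p q v : polarv p q v v = 2%:R *: grad (hesse p q) v.
Proof. by rewrite grad_hesse; apply/rowP => i; rewrite !mxE; ring. Qed.

Lemma euler_hesse p q v : dot (grad (hesse p q) v) v = 3%:R * (hesse p q).@[v 0].
Proof.
rewrite grad_hesse (meval_hesse _ _ _ 0) /dot (sum3_cyc _ 0) !mxE !cycE.
by ring.
Qed.

Lemma hessian_hesse p q : hessian (hesse p q) =
  hesse (- 6%:R * p * q ^+ 2) (216%:R * p ^+ 3 + 2%:R * q ^+ 3).
Proof.
rewrite /hessian det3 !mxE !mderiv2_hesse /= /hesse (sum3_cyc _ 0) (prod3_cyc _ 0).
have -> : (0 : 'I_3) + 1 = 1 by apply: val_inj.
have -> : (0 : 'I_3) + 2%:R = 2%:R by apply: val_inj.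
have -> : (1 : 'I_3) + 1 = 2%:R by apply: val_inj.
have -> : (1 : 'I_3) + 2%:R = 0 by apply: val_inj.
have -> : (2%:R : 'I_3) + 1 = 0 by apply: val_inj.
have -> : (2%:R : 'I_3) + 2%:R = 1 by apply: val_inj.
by ring.
Qed.

(** The Hessian at u is the determinant of v |-> [polarv p q u v]. *)
Lemma hessian_ker p q u v : v != 0 -> polarv p q u v = 0 ->
  (hessian (hesse p q)).@[u 0] = 0.
Proof.
move=> v0 uv; rewrite /hessian -det_map_mx; apply/eqP/det0P; exists v => //.
apply/rowP => j; transitivity (polarv p q u v 0 j); last by rewrite uv.
rewrite mxE -dot_grad_mderiv; apply: eq_bigr => i _.
by rewrite !mxE mderiv_comm mulrC.
Qed.

(** At a singular point 3 p x_i^2 = - q x_(i+1) x_(i+2) for all i. The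
    product of these equations is (27 p^3 + q^3) (x y z)^2 = 0, so some
    coordinate vanishes, and then all of them do. Conversely (1 : 0 : 0) is
    singular if p = 0, and (-3p : q : q) if 27 p^3 + q^3 = 0. *)
Lemma nonsingular_hesseP p q :
  nonsingular_cubic (hesse p q) <-> p != 0 /\ 27%:R * p ^+ 3 + q ^+ 3 != 0.
Proof.
have sing v : v != 0 -> grad (hesse p q) v = 0 -> singular_point (hesse p q) (nrm v).
  move=> v0 g0; have [c c0 E] := nrmP v0.
  have H i : (hesse p q)^`M(i).@[v 0] = 0.
    by move/rowP: g0 => /(_ i); rewrite !mxE.
  split.
    have : (hesse p q).@[v 0] = 0.
      apply: (mulfI (natK 2)); rewrite mulr0 -euler_hesse g0 dotE !mxE.
      by ring.
    rewrite {1}E (meval_homog _ _ (hesse_homog p q)) => /eqP.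
    by rewrite mulf_eq0 expf_eq0 (negPf c0) => /eqP.
  move=> i; move: (H i).
  rewrite {1}E (meval_homog _ _ (mderiv_homog i (hesse_homog p q))).
  by move=> /eqP; rewrite mulf_eq0 expf_eq0 (negPf c0) => /eqP.
split=> [[_ ns]|[p0 d0]]; last first.
  split=> [|P [_ sP]]; first exact: hesse_homog.
  have g i : 3%:R * p * P 0 i ^+ 2 + q * (P 0 (i + 1) * P 0 (i + 2%:R)) = 0.
    by have /rowP/(_ i) := grad_hesse p q P; rewrite !mxE => <-; apply: sP.
  have zero i : P 0 i = 0 -> P 0 (i + 1) = 0.
    move=> Pi; have := g (i + 1); rewrite !cycE Pi !mulr0 addr0 => /eqP.
    by rewrite !mulf_eq0 (negPf p0) (negPf (natK 2)) /= orbb => /eqP.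
  have [i Pi] : exists i, P 0 i = 0.
    have [[g0 g1] g2] := (g 0, g (0 + 1), g (0 + 2%:R)); rewrite !cycE in g1 g2.
    have : (27%:R * p ^+ 3 + q ^+ 3) * (P 0 0 * P 0 (0 + 1) * P 0 (0 + 2%:R)) ^+ 2 = 0.
      apply: (lin_comb3
        (c := 3%:R * p * P 0 (0 + 1) ^+ 2 * (3%:R * p * P 0 (0 + 2%:R) ^+ 2))
        (d := - (q * (P 0 (0 + 1) * P 0 (0 + 2%:R)) * (3%:R * p * P 0 (0 + 2%:R) ^+ 2)))
        (e := q * (P 0 (0 + 1) * P 0 (0 + 2%:R)) * (q * (P 0 (0 + 2%:R) * P 0 0)))
        g0 g1 g2).
      by ring.
    move/eqP; rewrite mulf_eq0 (negPf d0) expf_eq0 /= !mulf_eq0.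
    by move=> /orP[/orP[]|] /eqP; eauto.
  have P1 := zero _ Pi; have P2 := zero _ P1; rewrite cycE in P2.
  have /eqP[] := proj2_neq0 P; apply/rowP => m; rewrite mxE.
  by case: (ord3_cycP i m) => ->.
have p0 : p != 0.
  apply/eqP => p0; apply: (ns (nrm (vec3 1 0 0))); apply: sing.
    by apply/eqP => /rowP/(_ 0); rewrite vec3E mxE => /eqP; rewrite oner_eq0.
  rewrite grad_hesse p0; apply/rowP => i.
  by case: (ord3P i) => ->; rewrite !mxE /= ; ring.
split=> //; apply/eqP => d0.
have q0 : q != 0.
  apply/eqP => q0; move/eqP: d0.
  by rewrite q0 expr0n addr0 mulf_eq0 expf_eq0 (negPf p0) (negPf (natK 26)).
apply: (ns (nrm (vec3 (- (3%:R * p)) q q))); apply: sing.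
  by apply/eqP => /rowP/(_ 1); rewrite vec3E mxE => /eqP; rewrite (negPf q0).
rewrite grad_hesse; apply/rowP => i.
case: (ord3P i) => ->; rewrite !mxE /=; [|ring|ring].
by rewrite -d0; ring.
Qed.

End Hesse.

(** * The nine inflection points *)

Section Flexes.
Variable K : fieldType.
Hypothesis char0 : [pchar K] =i pred0.
Variable w : K.
Hypothesis w2 : w ^+ 2 + w + 1 = 0.
Implicit Types (F G : {mpoly K[3]}) (u v : 'rV[K]_3).
Implicit Types (P Q R X l : proj2 K) (p q : K) (a b c : 'I_3 * 'I_3).

Lemma w3 : w ^+ 3 = 1.
Proof. by apply: (lin_comb1 (c := w - 1) w2); ring. Qed.

Lemma pow_w_add (i j : 'I_3) : w ^+ (i + j)%R = w ^+ i * w ^+ j.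
Proof. by rewrite -exprD; apply: (expr_mod (i + j)%N w3). Qed.

Lemma pow_w3 (j : 'I_3) : (w ^+ j) ^+ 3 = 1.
Proof. by rewrite exprAC w3 expr1n. Qed.

Lemma w_neq1 : w != 1.
Proof.
apply/eqP => w1; have := w2; rewrite w1 expr1n; apply/eqP.
have -> : 1 + 1 + 1 = 3%:R :> K by ring.
by rewrite (negPf (natK char0 2)).
Qed.

Lemma w_neq0 : w != 0.
Proof. by apply: contraNneq w_neq1 => w0; rewrite -w3 w0 expr0n. Qed.

Lemma pow_w_inj : injective (fun j : 'I_3 => w ^+ j).
Proof.
have n2 : w ^+ 2 != 1.
  by apply: contraNneq w_neq1 => E; rewrite -w3 exprS E mulr1.
have n12 : w ^+ 2 != w.
  by apply: contraNneq w_neq1 => E; rewrite -w3 exprS E -expr2 E.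
move=> i j; case: (ord3P i) => ->; case: (ord3P j) => -> //=;
  rewrite /= ?expr0 ?expr1 -?[(1 %% 3 + 1 %% 3) %% 3]/2%N => /eqP;
  by rewrite ?[1 == _]eq_sym ?[w == w ^+ 2]eq_sym ?(negPf w_neq1) ?(negPf n2)
    ?(negPf n12).
Qed.

Lemma cube_rootP e : e ^+ 3 = 1 -> exists j : 'I_3, e = w ^+ j.
Proof.
move=> e3; have : (e - 1) * (e - w) * (e - w ^+ 2) = 0.
  by apply: (lin_comb3 (c := 1) (d := e - e ^+ 2) (e := e - 1) e3 w2 w3); ring.
move/eqP; rewrite !mulf_eq0 !subr_eq0 => /orP[/orP[]|] /eqP ->.
- by exists 0.
- by exists 1.
- by exists 2%:R.
Qed.

(** The points (0 : 1 : -e) with e^3 = 1 and their images under cyclic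
    permutations of the coordinates. With this choice of signs and
    exponents, collinearity becomes a sum equal to 0 in (Z/3)^2, see
    [collinear_flex]. *)
Definition flexv a : 'rV[K]_3 :=
  \row_m if m == a.1 then 0 else if m == a.1 + 1 then 1 else - w ^+ a.2.

Definition tangentv p q a : 'rV[K]_3 :=
  \row_m if m == a.1 then - q * w ^+ a.2 else
         if m == a.1 + 1 then 3%:R * p else 3%:R * p * (w ^+ a.2) ^+ 2.

Definition flex a : proj2 K := nrm (flexv a).

Lemma flexvE a : (flexv a 0 a.1 = 0) * (flexv a 0 (a.1 + 1) = 1) *
  (flexv a 0 (a.1 + 2%:R) = - w ^+ a.2).
Proof. by rewrite !mxE !cycE !eqxx. Qed.

Lemma tangentvE p q a : (tangentv p q a 0 a.1 = - q * w ^+ a.2) *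
  (tangentv p q a 0 (a.1 + 1) = 3%:R * p) *
  (tangentv p q a 0 (a.1 + 2%:R) = 3%:R * p * (w ^+ a.2) ^+ 2).
Proof. by rewrite !mxE !cycE !eqxx. Qed.

Lemma flexv_neq0 a : flexv a != 0.
Proof.
by apply/eqP => /rowP/(_ (a.1 + 1)); rewrite flexvE mxE => /eqP; rewrite oner_eq0.
Qed.

Lemma pow_w_neq0 (j : nat) : w ^+ j != 0.
Proof. by rewrite expf_neq0 // w_neq0. Qed.

Lemma flexv_eq0 a i : (flexv a 0 i == 0) = (i == a.1).
Proof.
case: (ord3_cycP a.1 i) => ->; rewrite flexvE ?cycE ?eqxx ?oner_eq0 //.
by rewrite oppr_eq0 (negPf (pow_w_neq0 _)).
Qed.

Lemma flex_inj : injective flex.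
Proof.
move=> a b E.
have [c c0 Ea] := nrmP (flexv_neq0 a); have [d d0 Eb] := nrmP (flexv_neq0 b).
have {E d0 c0 Ea Eb} [e Ee] : exists e, flexv a = e *: flexv b.
  exists (c / d); rewrite Eb scalerA mulfVK // [LHS]Ea; congr (_ *: coords _).
  exact: E.
have a1 : a.1 = b.1.
  by apply/eqP; rewrite eq_sym -flexv_eq0 Ee mxE flexvE mulr0.
have e1 : e = 1.
  by have /rowP/(_ (a.1 + 1)) := Ee; rewrite flexvE mxE a1 flexvE mulr1.
have /rowP/(_ (a.1 + 2%:R)) := Ee.
rewrite flexvE mxE a1 flexvE e1 mul1r => /oppr_inj/pow_w_inj a2.
by case: a b a1 a2 {Ee} => [? ?] [? ?] /= -> ->.
Qed.

Lemma grad_flex p q a : grad (hesse p q) (flexv a) = tangentv p q a.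
Proof.
rewrite grad_hesse; apply/rowP => m; rewrite mxE.
by case: (ord3_cycP a.1 m) => ->; rewrite ?cycE !flexvE !tangentvE; ring.
Qed.

Lemma tangent_flex p q a b : dot (tangentv p q a) (flexv b) =
  if b.1 == a.1 then 3%:R * p * (1 - (w ^+ a.2) ^+ 2 * w ^+ b.2) else
  if b.1 == a.1 + 1 then (w ^+ a.2) ^+ 2 * (3%:R * p) + q * w ^+ a.2 * w ^+ b.2
  else - (q * w ^+ a.2 + 3%:R * p * w ^+ b.2).
Proof.
rewrite /dot (sum3_cyc _ a.1) !tangentvE.
have [] := ord3_cycP a.1 b.1 => E; rewrite E ?cycE ?eqxx.
- by rewrite -E !flexvE; ring.
- have -> : a.1 = b.1 + 2%:R by rewrite E cycE.
  by rewrite !cycE !flexvE; ring.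
- have -> : a.1 = b.1 + 1 by rewrite E cycE.
  by rewrite !cycE !flexvE; ring.
Qed.

Section SmoothMember.
Variables p q : K.
Hypothesis p0 : p != 0.
Hypothesis d0 : 27%:R * p ^+ 3 + q ^+ 3 != 0.

Let ns : nonsingular_cubic (hesse p q).
Proof. exact/(nonsingular_hesseP char0). Qed.

(** The sum of the cubes of 3 p and q e is 27 p^3 + q^3. *)
Lemma smooth_sum (e : K) : e ^+ 3 = 1 -> 3%:R * p + q * e != 0.
Proof.
move=> e3; apply: contraNneq d0 => E; apply/eqP.
apply: (lin_comb2 (c := 9%:R * p ^+ 2 - 3%:R * p * (q * e) + (q * e) ^+ 2)
  (d := - q ^+ 3) E e3).
by ring.
Qed.

Lemma tangent_flex_eq0 a b : (dot (tangentv p q a) (flexv b) == 0) = (a == b).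
Proof.
rewrite tangent_flex.
have e3 := pow_w3 a.2; have e3' := pow_w3 b.2.
have sqM3 e f : e ^+ 3 = 1 -> f ^+ 3 = 1 -> (e ^+ 2 * f) ^+ 3 = 1 :> K.
  by move=> h h'; apply: (lin_comb2 (c := (e ^+ 3 + 1) * f ^+ 3) (d := 1) h h'); ring.
have e0 := pow_w_neq0 a.2; have e0' := pow_w_neq0 b.2.
case: (eqVneq b.1 a.1) => ab1.
  rewrite !mulf_eq0 (negPf p0) (negPf (natK char0 2)) /= subr_eq0 eq_sym.
  have -> : ((w ^+ a.2) ^+ 2 * w ^+ b.2 == 1) = (a.2 == b.2).
    rewrite -(inj_eq pow_w_inj) -(inj_eq (mulfI e0) _ 1) mulrA -exprS e3 mul1r mulr1.
    by rewrite eq_sym.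
  by case: a b ab1 {e3 e3' e0 e0'} => [? ?] [? ?] /= ->; rewrite xpair_eqE eqxx.
have -> : (a == b) = false by apply: contraNF ab1 => /eqP ->.
case: (eqVneq b.1 (a.1 + 1)) => _; apply/negbTE.
  have -> : (w ^+ a.2) ^+ 2 * (3%:R * p) + q * w ^+ a.2 * w ^+ b.2 =
      (w ^+ a.2) ^+ 2 * (3%:R * p + q * ((w ^+ a.2) ^+ 2 * w ^+ b.2)).
    by apply: (lin_comb1 (c := - q * w ^+ a.2 * w ^+ b.2) e3); ring.
  apply: mulf_neq0; first exact: expf_neq0.
  exact: (smooth_sum (sqM3 _ _ e3 e3')).
have -> : q * w ^+ a.2 + 3%:R * p * w ^+ b.2 =
    w ^+ b.2 * (3%:R * p + q * ((w ^+ b.2) ^+ 2 * w ^+ a.2)).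
  by apply: (lin_comb1 (c := - q * w ^+ a.2) e3'); ring.
rewrite oppr_eq0; apply: mulf_neq0 => //.
exact: (smooth_sum (sqM3 _ _ e3' e3)).
Qed.

(** A flexional tangent meets the cubic in the flex alone because, modulo the
    equation of the tangent, the cubic is a multiple of the cube of a
    coordinate. *)
Lemma hesse_tangent a : exists G, (27%:R * p ^+ 2) *: hesse p q =
  linv (tangentv p q a) * G + (27%:R * p ^+ 3 + q ^+ 3) *: 'X_(a.1) ^+ 3.
Proof.
pose A : {mpoly K[3]} := (3%:R * p)%:MP * 'X_(a.1 + 1).
pose B : {mpoly K[3]} := (3%:R * p * (w ^+ a.2) ^+ 2)%:MP * 'X_(a.1 + 2%:R).
pose C : {mpoly K[3]} := (- q * w ^+ a.2)%:MP * 'X_(a.1).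
have e3 : (w ^+ a.2)%:MP ^+ 3 = 1 :> {mpoly K[3]} by rewrite -rmorphXn /= pow_w3.
exists (A ^+ 2 + B ^+ 2 + C ^+ 2 - A * B - B * C - C * A).
have -> : linv (tangentv p q a) = A + B + C.
  rewrite /linv (sum3_cyc _ a.1) !tangentvE -!mul_mpolyC /A /B /C.
  by rewrite -addrA addrC.
rewrite /hesse (sum3_cyc _ a.1) (prod3_cyc _ a.1) /A /B /C -!mul_mpolyC.
move: (w ^+ a.2) e3 => e e3.
apply: (lin_comb1 (c := - (27%:R * p%:MP ^+ 3 * 'X_(a.1 + 2%:R) ^+ 3 * (e%:MP ^+ 3 + 1))
   + q%:MP ^+ 3 * 'X_(a.1) ^+ 3
   + 27%:R * p%:MP ^+ 2 * q%:MP * - ('X_(a.1) * 'X_(a.1 + 1) * 'X_(a.1 + 2%:R))) e3).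
by ring.
Qed.

Lemma on_tangent a v : dot (tangentv p q a) v = 0 -> v 0 a.1 = 0 ->
  v = v 0 (a.1 + 1) *: flexv a.
Proof.
move=> tv v0; apply/rowP => m; rewrite mxE.
case: (ord3_cycP a.1 m) => ->; rewrite flexvE ?v0 ?mulr0 ?mulr1 //.
move: tv; rewrite /dot (sum3_cyc _ a.1) v0 mulr0 add0r !tangentvE => tv.
have e3 := pow_w3 a.2; set e := w ^+ a.2 in e3 tv *.
apply: (mulfI (mulf_neq0 (natK char0 2) p0)).
apply: (lin_comb2 (c := e) (d := - 3%:R * p * v 0 (a.1 + 2%:R)) tv e3).
by ring.
Qed.

End SmoothMember.
End Flexes.

(** * The group law on the inflection points *)

Section GroupLaw.
Variable K : fieldType.
Hypothesis char0 : [pchar K] =i pred0.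
Variable w : K.
Hypothesis w2 : w ^+ 2 + w + 1 = 0.
Variables p q : K.
Hypothesis p0 : p != 0.
Hypothesis d0 : 27%:R * p ^+ 3 + q ^+ 3 != 0.
Implicit Types (u v : 'rV[K]_3) (P Q R S X l : proj2 K) (a b : 'I_3 * 'I_3).

Notation F := (hesse p q).
Notation flex := (@flex K w).
Notation flexv := (@flexv K w).
Notation tangentv := (@tangentv K w p q).

Lemma flexP a : exists2 c, c != 0 & flexv a = c *: (flex a : 'rV_3).
Proof. exact: nrmP (flexv_neq0 w a). Qed.

Lemma eq_flex X a c : (X : 'rV_3) = c *: flexv a -> X = flex a.
Proof.
move=> E; have c0 : c != 0.
  by apply: contraNneq (proj2_neq0 X) => c0; rewrite E c0 scale0r.
apply/esym/(@nrm_eq _ _ _ c^-1); first by rewrite invr_eq0.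
by rewrite E scalerA mulVf // scale1r.
Qed.

Lemma on_flex a : on F (flex a).
Proof.
have [c c0 E] := flexP a; have : F.@[flexv a 0] = 0.
  rewrite (meval_hesse _ _ _ a.1) !flexvE; have := pow_w3 w2 a.2 => e3.
  by apply: (lin_comb1 (c := - p) e3); ring.
rewrite E (meval_homog _ _ (hesse_homog p q)) => /eqP.
by rewrite mulf_eq0 expf_eq0 (negPf c0) => /eqP.
Qed.

Lemma grad_neq0 P : grad F P != 0.
Proof.
have [_ ns] := (nonsingular_hesseP char0 p q).2 (conj p0 d0).
apply/eqP => g0; apply: (ns P); split.
  apply: (mulfI (natK char0 2)); rewrite mulr0 -euler_hesse g0 dotE !mxE.
  by ring.
by move=> i; move/rowP: g0 => /(_ i); rewrite !mxE.
Qed.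

Lemma euler_on P : on F P -> dot (grad F P) P = 0.
Proof. by rewrite euler_hesse => ->; rewrite mulr0. Qed.

Lemma grad_flexP a : exists2 c, c != 0 & grad F (flex a) = c *: tangentv a.
Proof.
have [c c0 E] := flexP a; exists (c ^- 2); first by rewrite invr_eq0 expf_neq0.
rewrite -grad_flex E !grad_hesse; apply/rowP => m; rewrite !mxE.
by field.
Qed.

Lemma mul_mmap_hesse_tangent a (g : 'rV[{poly K}]_3) : exists h : {poly K},
  (27%:R * p ^+ 2)%:P * mmap polyC (g 0) F =
  mmap polyC (g 0) (linv (tangentv a)) * h
    + (27%:R * p ^+ 3 + q ^+ 3)%:P * g 0 a.1 ^+ 3.
Proof.
have [G E] := hesse_tangent w2 p q a; exists (mmap polyC (g 0) G).
rewrite -mmapZ E mmapD rmorphM mmapZ rmorphXn /=.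
by rewrite mmapX mmap1U.
Qed.

Lemma dvdX_coef0 (f : {poly K}) : ('X %| f) = (f`_0 == 0).
Proof. by rewrite -['X]subr0 -polyC0 dvdp_XsubCl /root horner_coef0. Qed.

Let c27 : 27%:R * p ^+ 2 != 0.
Proof. by rewrite mulf_neq0 ?expf_neq0 // (natK char0 26). Qed.

Lemma has_ord_tangent a X :
  has_ord F X (linv (tangentv a)) ((X == flex a) + (X == flex a) + (X == flex a))%N.
Proof.
have [c c0 Ef] := flexP a.
have tf : dot (tangentv a) (flex a) = 0.
  have : dot (tangentv a) (flexv a) = 0 by apply/eqP; rewrite tangent_flex_eq0.
  by rewrite Ef dotZr => /eqP; rewrite mulf_eq0 (negPf c0) => /eqP.
have fi : flex a 0 a.1 = 0.
  have : flexv a 0 a.1 = 0 by rewrite flexvE.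
  by rewrite Ef mxE => /eqP; rewrite mulf_eq0 (negPf c0) => /eqP.
case: (eqVneq X (flex a)) => [->|/eqP Xa]; last first.
  apply: has_ord0; rewrite /on meval_linv => -[FX tX]; apply: Xa.
  apply: (@eq_flex _ _ (X 0 (a.1 + 1))); apply: (on_tangent char0 w2 p0 tX).
  have [G /(congr1 (meval (X 0)))] := hesse_tangent w2 p q a.
  rewrite mevalZ FX mevalD mevalM meval_linv tX mevalZ rmorphXn /= mevalXU.
  move/esym/eqP; rewrite mulr0 mul0r add0r mulf_eq0 (negPf d0) expf_eq0 /=.
  by move/eqP.
split.
  (* Along the straight arc in the direction v of the tangent, the cubic is
     a multiple of t^3. *)
  pose v : 'rV[K]_3 := \row_m if m == a.1 then 3%:R * p else
    if m == a.1 + 1 then q * w ^+ a.2 else 0.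
  have vE : (v 0 a.1 = 3%:R * p) * (v 0 (a.1 + 1) = q * w ^+ a.2) *
    (v 0 (a.1 + 2%:R) = 0) by rewrite !mxE !cycE !eqxx.
  have tv : dot (tangentv a) v = 0.
    by rewrite /dot (sum3_cyc _ a.1) !tangentvE !vE; ring.
  pose g := map_mx polyC (flex a : 'rV_3) + 'X *: map_mx polyC v.
  have cf k : map_mx (coefp k) g =
      if k is 0 then flex a : 'rV_3 else if k is 1 then v else 0.
    by apply/rowP => i; case: k => [|[|k]];
      rewrite !mxE /= coefD coefXM !coefC /= ?addr0 ?add0r.
  have lin0 : mmap polyC (g 0) (linv (tangentv a)) = 0.
    apply/polyP => k; rewrite coef_mmap_linv cf coef0.
    by case: k => [|[|k]] //; rewrite dotE !mxE; ring.
  exists g; rewrite !cf; split=> //; last by rewrite lin0 dvdp0.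
    apply/not_subP/eqP => /(cross_eq0 (proj2_neq0 _))[e].
    move/rowP/(_ a.1); rewrite vE mxE fi mulr0 => /eqP.
    by rewrite mulf_eq0 (negPf p0) (negPf (natK char0 2)).
  have [h] := mul_mmap_hesse_tangent a g; rewrite lin0 mul0r add0r => E.
  rewrite -(dvdpZr _ _ c27) -mul_polyC E; apply: dvdp_mull.
  apply: dvdp_exp2r; rewrite dvdX_coef0.
  by have /rowP/(_ a.1) := cf 0%N; rewrite !mxE /= => ->; rewrite fi.
case=> g [g0 /not_subP g1 gF gt].
(* An arc on the cubic and on the tangent modulo t^4 has x_i divisible by
   t^2, so that its direction would be the point itself. *)
have [h E] := mul_mmap_hesse_tangent a g.
have gi : 'X^4 %| g 0 a.1 ^+ 3.
  rewrite -(dvdpZr _ _ d0) -mul_polyC -(dvdp_addr _ (dvdp_mulr h gt)) -E.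
  exact: dvdp_mull.
have gi0 : 'X %| g 0 a.1.
  by rewrite dvdX_coef0; move/rowP/(_ a.1): g0; rewrite mxE /= => ->; rewrite fi.
have [r rE] := dvdpP _ _ gi0.
have v0 : map_mx (coefp 1) g 0 a.1 = 0.
  rewrite mxE /= rE coefMX /=; apply/eqP; rewrite -dvdX_coef0.
  move: gi; rewrite rE exprMn [X in X %| _]exprS dvdp_mul2r; last first.
    by rewrite expf_neq0 // polyX_eq0.
  by rewrite !dvdX_coef0 -!horner_coef0 horner_exp expf_eq0.
have tv : dot (tangentv a) (map_mx (coefp 1) g) = 0.
  by move/dvdXnP: gt => /(_ 1%N isT); rewrite coef_mmap_linv.
have := on_tangent char0 w2 p0 tv v0; rewrite Ef scalerA => E1.
by move/eqP: g1; apply; rewrite E1 crossZr.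
Qed.

Lemma line_section_lin v P Q R : v != 0 ->
  (forall X, has_ord F X (linv v) ((X == P) + (X == Q) + (X == R))%N) ->
  line_section F P Q R.
Proof.
move=> v0 h; have [c c0 E] := nrmP v0; exists (nrm v) => X.
by move: (h X); rewrite {1}E linvZ => /(has_ordZr _ _ _ _ c0).
Qed.

Lemma tangentv_neq0 a : tangentv a != 0.
Proof.
apply/eqP => /rowP/(_ (a.1 + 1)); rewrite tangentvE mxE => /eqP.
by rewrite mulf_eq0 (negPf p0) (negPf (natK char0 2)).
Qed.

(** Three of the points that lie on the same coordinate line are trivially
    collinear; for three that lie on different ones the determinant is, up
    to sign, 1 minus a product of three powers of w. *)
Lemma collinear_flex a b :
  dot (cross (flexv a) (flexv b)) (flexv (- (a + b))) = 0.
Proof.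
case: a b => [i j] [k l].
have -> : - ((i, j) + (k, l)) = (- (i + k), - (j + l)) by [].
have z1 : w ^+ j * w ^+ l * w ^+ (- (j + l))%R = 1.
  by rewrite -!(pow_w_add w2) subrr.
have fE (m : 'I_3) n : flexv (m, n) = if m == 0 then vec3 0 1 (- w ^+ n) else
    if m == 1 then vec3 (- w ^+ n) 0 1 else vec3 1 (- w ^+ n) 0.
  by apply: row3P; case: (ord3P m) => ->; rewrite !mxE.
rewrite !fE dotE; move: (w ^+ _) (w ^+ _) (w ^+ _) z1 => x y z z1.
by case: (ord3P i) => ->; case: (ord3P k) => ->; rewrite /= /cross !vec3E;
  first [ring | apply: (lin_comb1 (c := 1) z1); ring
        | apply: (lin_comb1 (c := - 1) z1); ring].
Qed.

Lemma hesse_chord u v (x y : K) : F.@[(x *: u + y *: v) 0] =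
  x ^+ 3 * F.@[u 0] + x ^+ 2 * y * dot (grad F u) v
  + x * y ^+ 2 * dot (grad F v) u + y ^+ 3 * F.@[v 0].
Proof.
rewrite !(meval_hesse _ _ _ 0) /dot !(sum3_cyc _ 0) !grad_hesse !mxE !cycE.
by ring.
Qed.

Lemma on_flexv a : F.@[flexv a 0] = 0.
Proof.
have [c c0 ->] := flexP a; rewrite (meval_homog _ _ (hesse_homog p q)).
by rewrite on_flex mulr0.
Qed.

Lemma flex_span a v (c : K) : v = c *: flexv a -> v != 0 -> nrm v = flex a.
Proof.
move=> E v0; apply/esym; rewrite E nrmZ ?flexv_neq0 //.
by apply: contraNneq v0 => c0; rewrite E c0 scale0r.
Qed.

Lemma neg_add_neq a b : a != b -> (- (a + b) != a) && (- (a + b) != b).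
Proof.
case: a b => [i j] [k l]; rewrite !xpair_eqE /=.
by case: (ord3P i) => ->; case: (ord3P j) => ->; case: (ord3P k) => ->;
  case: (ord3P l) => ->.
Qed.

Lemma neg_addxx a : - (a + a) = a.
Proof.
by case: a => [i j]; congr (_, _); [case: (ord3P i) => ->|case: (ord3P j) => ->];
  apply: val_inj.
Qed.

(** On the chord with coordinates x, y the cubic restricts to x y (f x + g
    y). Both f and g are values of a flexional tangent at another inflection
    point, hence nonzero, and the three zeros are simple. *)
Lemma line_section_flex a b :
  line_section F (flex a) (flex b) (flex (- (a + b))).
Proof.
case: (eqVneq a b) => [<-|ab].
  rewrite neg_addxx; apply: (line_section_lin (tangentv_neq0 a)).
  exact: has_ord_tangent.
have := neg_add_neq ab; have := collinear_flex a b.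
move: (- (a + b)) => c abc /andP[ca cb].
have l0 : cross (flexv a) (flexv b) != 0.
  apply: contraNneq ab => /(cross_eq0 (flexv_neq0 w a))[e E].
  apply/eqP/esym/(flex_inj char0 w2).
  by rewrite -(flex_span E (flexv_neq0 w b)).
apply: (line_section_lin l0) => X.
set L := cross _ _ in l0 abc *.
have La : dot L (flexv a) = 0 by apply: dot_crossl.
have Lb : dot L (flexv b) = 0 by apply: dot_crossr.
have ord1 x y : x != y -> dot L (flexv x) = 0 -> dot L (flexv y) = 0 ->
    has_ord F (flex x) (linv L) 1.
  move=> xy Lx Ly; have [e e0 Ex] := flexP x; split.
    apply/ord_ge1P; split; first exact: on_flex.
    rewrite /on meval_linv; move: Lx; rewrite Ex dotZr => /eqP.
    by rewrite mulf_eq0 (negPf e0) => /eqP.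
  move=> h; have [r Er] := ord_ge2_grad h (euler_on (on_flex x)) (grad_neq0 _).
  have r0 : r != 0 by apply: contraNneq l0 => r0; rewrite Er r0 scale0r.
  have [s s0 Es] := grad_flexP x.
  move: Ly; rewrite Er Es !dotZl => /eqP.
  rewrite !mulf_eq0 (negPf r0) (negPf s0) /=.
  by rewrite (tangent_flex_eq0 char0 w2 p0 d0) (negPf xy).
have neqF x y : x != y -> (flex x == flex y) = false.
  by move=> xy; rewrite (inj_eq (flex_inj char0 w2)) (negPf xy).
have ba : b != a by rewrite eq_sym.
have ac : a != c by rewrite eq_sym.
have bc : b != c by rewrite eq_sym.
case: (eqVneq X (flex a)) => [->|/eqP Xa].
  by rewrite !neqF //; apply: ord1 ab _ _.
case: (eqVneq X (flex b)) => [->|/eqP Xb].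
  by rewrite !neqF //; apply: ord1 ba _ _.
case: (eqVneq X (flex c)) => [->|/eqP Xc].
  by apply: ord1 ca _ _.
apply: has_ord0; rewrite {1}/on /on meval_linv => -[FX LX].
have [x [y E]] := span2 l0 l0 La Lb LX.
have [r [s Ec]] := span2 l0 l0 La Lb abc.
have := on_flexv c; rewrite Ec; move: FX; rewrite E !hesse_chord !on_flexv.
rewrite !grad_flex !mulr0 !addr0 !add0r.
have tab : dot (tangentv a) (flexv b) != 0.
  by rewrite (tangent_flex_eq0 char0 w2 p0 d0).
have tba : dot (tangentv b) (flexv a) != 0.
  by rewrite (tangent_flex_eq0 char0 w2 p0 d0).
move: (dot _ _) (dot _ _) tab tba => g f f0 g0 Exy Ers.
have r0 : r != 0.
  apply: contraNneq cb => r0; apply/eqP/(flex_inj char0 w2).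
  by apply: (flex_span (c := s) _ (flexv_neq0 w c)); rewrite Ec r0 scale0r add0r.
have s0 : s != 0.
  apply: contraNneq ca => s0; apply/eqP/(flex_inj char0 w2).
  by apply: (flex_span (c := r) _ (flexv_neq0 w c)); rewrite Ec s0 scale0r addr0.
have x0 : x != 0.
  by apply/eqP => x0; apply: Xb; apply: (eq_flex (c := y)); rewrite E x0 scale0r add0r.
have y0 : y != 0.
  by apply/eqP => y0; apply: Xa; apply: (eq_flex (c := x)); rewrite E y0 scale0r addr0.
have {}Exy : x * f + y * g = 0.
  by apply: (mulfI (mulf_neq0 x0 y0)); rewrite mulr0 -[RHS]Exy; ring.
have {}Ers : r * f + s * g = 0.
  by apply: (mulfI (mulf_neq0 r0 s0)); rewrite mulr0 -[RHS]Ers; ring.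
have rs : r * y = x * s.
  by apply: (mulIf g0); apply: (lin_comb2 (c := r) (d := - x) Exy Ers); ring.
apply: Xc; apply: (eq_flex (c := x / r)).
rewrite E Ec scalerDr !scalerA mulfVK //; congr (_ + _ *: _).
by apply: (mulfI r0); rewrite rs; field.
Qed.

Lemma line_section_det P Q R R' :
  line_section F P Q R -> line_section F P Q R' -> R = R'.
Proof.
apply: line_section_uniq => FP; split; [exact: grad_neq0|exact: euler_on].
Qed.

Lemma line_sectionAC P Q R : line_section F P Q R -> line_section F P R Q.
Proof. by case=> l hl; exists l => X; rewrite addnAC. Qed.

Lemma line_sectionC P Q R : line_section F P Q R -> line_section F Q P R.
Proof. by case=> l hl; exists l => X; rewrite (addnC (X == Q)). Qed.

(** The tangent at an inflection point P meets the curve to the third order, so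
    the quadratic form of second derivatives at P vanishes on the plane of
    vectors lying over that tangent, which makes it degenerate. *)
Lemma inflection_hessian P : inflection_point F P -> on (hessian F) P.
Proof.
case=> l /(_ P)[h _]; rewrite eqxx in h.
have [FP _] : on F P /\ on (lin l) P by apply/ord_ge1P; apply: ord_ge_le h.
have [v [x [Pv [lP lv lx] gv gx]]] := ord_ge3_linv h.
have gP := euler_on FP.
have [a [b xE]] := span2 Pv (proj2_neq0 l) lP lv lx.
have hv : dot (polarv p q P v) v = 0.
  move: gx; rewrite xE dotDr !dotZr gP gv !mulr0 addr0 mul0rn addr0.
  by move=> <-; apply: eq_bigr => i _; rewrite dot_grad_mderiv.
have hP : dot (polarv p q P v) P = 0.
  by rewrite dot_polarvC polarv_diag dotZl gv mulr0.
have [s Es] := perp2 Pv hP hv; have [r Er] := perp2 Pv gP gv.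
have r0 : r != 0.
  by apply: contraNneq (grad_neq0 P) => r0; rewrite Er r0 scale0r.
apply: (@hessian_ker _ _ _ _ ((2%:R * r) *: v - s *: (P : 'rV_3))).
  apply: contraNneq Pv => /eqP; rewrite subr_eq0 => /eqP E.
  have -> : v = (s / (2%:R * r)) *: (P : 'rV_3).
    apply: (scalerI (mulf_neq0 (natK char0 1) r0)); rewrite E scalerA; congr (_ *: _).
    by field; rewrite r0 (natK char0 1).
  by rewrite crossZr.
rewrite -scaleNr polarvDr !polarvZr Es polarv_diag Er !scalerA -scalerDl.
by rewrite [X in X *: _](_ : _ = 0) ?scale0r //; ring.
Qed.

(** The cubic and its Hessian are different members of the pencil, so at
    their common points both x^3 + y^3 + z^3 and x y z vanish. *)
Lemma inflection_hesseP P : inflection_point F P <-> exists a, P = flex a.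
Proof.
split=> [hP|[a ->]]; last first.
  by have := line_section_flex a a; rewrite neg_addxx.
have := inflection_hessian hP; rewrite hessian_hesse => h1.
have h0 : on F P.
  case: hP => l /(_ P)[h _]; rewrite eqxx in h.
  by have [] := (ord_ge1P F P (lin l)).1 (ord_ge_le (isT : 1 <= 3)%N h).
(* The determinant of the two equations in the unknowns x^3 + y^3 + z^3 and
   x y z. *)
have dis : 8%:R * p * (27%:R * p ^+ 3 + q ^+ 3) != 0.
  by rewrite !mulf_neq0 ?(natK char0 7).
have cond i : P 0 i * P 0 (i + 1) * P 0 (i + 2%:R) = 0 /\
    P 0 i ^+ 3 + P 0 (i + 1) ^+ 3 + P 0 (i + 2%:R) ^+ 3 = 0.
  rewrite /on !(meval_hesse _ _ _ i) in h0 h1.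
  split; apply: (mulfI dis); rewrite mulr0.
    by apply: (lin_comb2 (c := 6%:R * p * q ^+ 2) (d := p) h0 h1); ring.
  by apply: (lin_comb2 (c := 216%:R * p ^+ 3 + 2%:R * q ^+ 3) (d := - q) h0 h1); ring.
have [i Pi] : exists i, P 0 i = 0.
  have [/eqP] := cond 0; rewrite !mulf_eq0 => /orP[/orP[]|] /eqP; eauto.
have [_] := cond i; rewrite Pi expr0n add0r => E.
have P1 : P 0 (i + 1) != 0.
  apply: contraNneq (proj2_neq0 P) => P1; apply/eqP/rowP => m; rewrite mxE.
  move: E; rewrite P1 expr0n add0r => /eqP; rewrite expf_eq0 /= => /eqP P2.
  by case: (ord3_cycP i m) => ->.
have [j Ej] : exists j : 'I_3, - P 0 (i + 2%:R) / P 0 (i + 1) = w ^+ j.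
  apply: (cube_rootP w2); apply: (mulIf (expf_neq0 3 P1)); rewrite -exprMn mulfVK //.
  by apply: (lin_comb1 (c := - 1) E); ring.
exists (i, j); apply: (eq_flex (c := P 0 (i + 1))); apply/rowP => m; rewrite mxE.
have [[f1 f2] f3] := flexvE w (i, j); rewrite /= in f1 f2 f3.
case: (ord3_cycP i m) => ->; rewrite ?f1 ?f2 ?f3 ?mulr0 ?mulr1 //.
by rewrite -Ej; field.
Qed.

Lemma flex_section a b S : line_section F (flex a) (flex b) S -> S = flex (- (a + b)).
Proof. by move=> h; apply: line_section_det h (line_section_flex a b). Qed.

Lemma add_flexP a b S : add F (flex 0) (flex a) (flex b) S <-> S = flex (a + b).
Proof.
split=> [[R [/flex_section -> /flex_section ->]]|->].
  by rewrite add0r opprK.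
exists (flex (- (a + b))); split; first exact: line_section_flex.
by have := line_section_flex 0 (- (a + b)); rewrite add0r opprK.
Qed.

(** Let R = P + P, and let R' be the third point on the tangent at P. Since the
    origin is an inflection point, R + P = O puts P on the line through O and R;
    but R' is the third point on that line, so R' = P. *)
Lemma tors3P P : tors3 F (flex 0) P <-> exists a, P = flex a.
Proof.
split=> [[R [[R' [PPR' OR'R]] [S [RPS OSO]]]]|[a ->]]; last first.
  by exists (flex (a + a)); split; apply/add_flexP => //; rewrite -{3}(neg_addxx a) subrr.
apply/inflection_hesseP; rewrite /inflection_point.
have SO : S = flex 0.
  have := flex_section (line_sectionAC OSO); rewrite add0r oppr0 => E.
  exact: E.
rewrite {}SO in RPS.
have E : R' = P.
  apply: (@line_section_det R (flex 0)); last exact: line_sectionAC.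
  exact/line_sectionAC/line_sectionC/line_sectionAC/line_sectionC.
by rewrite E in PPR'.
Qed.

End GroupLaw.

(** * The Weil pairing on the inflection points *)

Local Notation idx := ('I_3 * 'I_3)%type.

(** The pair (s, j) stands for the sixth root of unity (-1)^s w^j, see
    [uval]. Products of such roots are then found by computation in finite
    types. *)
Definition umul (x y : bool * 'I_3) := (x.1 (+) y.1, x.2 + y.2).
Definition uinv (x : bool * 'I_3) := (x.1, - x.2).

(** The root of unity by which the tangent at a, evaluated at x, differs
    from a function of x - a, see [tau_tangent]. *)
Definition cocycle (a x : idx) : bool * 'I_3 :=
  if x.1 - a.1 == 0 then (false, 0) else
  if x.1 - a.1 == 1 then (false, - a.2) else (true, x.2).

(** The root of unity that [tau] acquires under y |-> - y, see [tau_parity]. *)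
Definition parity (y : idx) : bool * 'I_3 :=
  if y.1 == 0 then (true, - y.2) else (false, 0).

(** What remains of the Weil pairing of a and b, computed with the auxiliary
    point s, when the values of [tau] have cancelled. *)
Definition weil_unit (a b s : idx) : bool * 'I_3 :=
  foldr umul (false, 0)
   [:: cocycle a (b + s); cocycle 0 s; cocycle b (- s); cocycle 0 (a - s);
      uinv (cocycle 0 (b + s)); uinv (cocycle a s); uinv (cocycle b (a - s));
      uinv (cocycle 0 (- s)); parity (b + s); parity (s - a);
      uinv (parity (b + s - a)); uinv (parity s)].

Definition symp (a b : idx) : 'I_3 := a.1 * b.2 - a.2 * b.1.

Definition idx_list : seq idx :=
  [seq (i, j) | i <- [:: 0; 1; 2%:R], j <- [:: 0; 1; 2%:R]].

(** The inequalities say that the four values in the definition of the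
    pairing are finite and nonzero. *)
Definition weil_check a b s :=
  [&& s != 0, s != a, s != - b, s != a - b & weil_unit a b s == (false, symp a b)].

Lemma weil_check_all :
  all (fun a => all (fun b => has (weil_check a b) idx_list) idx_list) idx_list.
Proof. by vm_compute. Qed.

Lemma mem_idx_list a : a \in idx_list.
Proof. by case: a => [i j]; case: (ord3P i) => ->; case: (ord3P j) => ->. Qed.

Lemma weil_shift_exists a b : exists s, weil_check a b s.
Proof.
have /allP/(_ a (mem_idx_list a)) := weil_check_all.
move=> /allP/(_ b (mem_idx_list b))/hasP[s _ h].
by exists s.
Qed.

Section Weil.
Variable K : fieldType.
Hypothesis char0 : [pchar K] =i pred0.
Variable w : K.
Hypothesis w2 : w ^+ 2 + w + 1 = 0.
Variables p q : K.
Hypothesis p0 : p != 0.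
Hypothesis d0 : 27%:R * p ^+ 3 + q ^+ 3 != 0.

Notation F := (hesse p q).
Notation flex := (@flex K w).
Notation flexv := (@flexv K w).
Notation tangentv := (@tangentv K w p q).

Definition uval (x : bool * 'I_3) : K := (-1) ^+ x.1 * w ^+ x.2.

Lemma uval_mul x y : uval (umul x y) = uval x * uval y.
Proof.
by rewrite /uval /= (pow_w_add w2) signr_addb mulrACA.
Qed.

Lemma uval_neq0 x : uval x != 0.
Proof. by rewrite mulf_neq0 ?signr_eq0 // (pow_w_neq0 char0 w2). Qed.

Lemma uval_inv x : uval (uinv x) = (uval x)^-1.
Proof.
apply: (mulfI (uval_neq0 x)); rewrite divff ?uval_neq0 // -uval_mul.
have -> : umul x (uinv x) = (false, 0) by congr (_, _); [exact: addbb|exact: subrr].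
by rewrite /uval mulr1.
Qed.

(** The value, up to a sixth root of unity, of the tangent at a in the inflection
    point a + y. *)
Definition tau (y : idx) : K :=
  if y.1 == 0 then 3%:R * p * (1 - w ^+ y.2) else
  if y.1 == 1 then 3%:R * p + q * w ^+ y.2 else 3%:R * p + q * w ^+ (- y.2)%R.

Lemma tau_tangent a x :
  dot (tangentv a) (flexv x) = uval (cocycle a x) * tau (x - a).
Proof.
rewrite tangent_flex /cocycle /tau -[(x - a).1]/(x.1 - a.1) -[(x - a).2]/(x.2 - a.2).
have e3 := pow_w3 w2 a.2; have e3' := pow_w3 w2 x.2.
have inv (j : 'I_3) : w ^+ (- j)%R = (w ^+ j) ^+ 2.
  apply: (mulfI (pow_w_neq0 char0 w2 j)).
  by rewrite -(pow_w_add w2) subrr -exprS (pow_w3 w2).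
have -> : (x.1 - a.1 == 1) = (x.1 == a.1 + 1) by rewrite subr_eq addrC.
rewrite subr_eq0; case: eqP => _; rewrite /uval [LHS]/=.
  by rewrite (pow_w_add w2) inv; ring.
case: eqP => _.
  rewrite (pow_w_add w2) inv.
  by apply: (lin_comb1 (c := - q * w ^+ a.2 * w ^+ x.2) e3); ring.
rewrite opprB (pow_w_add w2) inv.
by apply: (lin_comb1 (c := q * w ^+ a.2) e3'); ring.
Qed.

Lemma tau_neq0 y : y != 0 -> tau y != 0.
Proof.
have := tangent_flex_eq0 char0 w2 p0 d0 0 y.
rewrite tau_tangent subr0 mulf_eq0 (negPf (uval_neq0 _)) /= => ->.
by rewrite eq_sym.
Qed.

Lemma tau_parity y : tau (- y) = uval (parity y) * tau y.
Proof.
rewrite /tau /parity -[(- y).1]/(- y.1) -[(- y).2]/(- y.2) oppr_eq0.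
have inv (j : 'I_3) : w ^+ (- j)%R * w ^+ j = 1.
  by rewrite -(pow_w_add w2) addNr.
case: eqP => [_|/eqP y0]; rewrite /uval.
  apply: (lin_comb1 (c := - 3%:R * p) (inv y.2)).
  by ring.
rewrite opprK !mul1r; move: y0.
by case: (ord3P y.1) => ->.
Qed.

Lemma div_tangent a :
  div_3P_3O F (flex 0) (flex a) (linv (tangentv a)) (linv (tangentv 0)).
Proof.
split; first by exists 1%N; split; apply: linv_homog.
move=> X _; do 2 eexists; split; [exact: has_ord_tangent|exact: has_ord_tangent|].
by rewrite addnC; congr addn; case: (_ == _).
Qed.

Lemma ratio_tangent a x : ratio (linv (tangentv a)) (linv (tangentv 0)) (flex x) =
  dot (tangentv a) (flexv x) / dot (tangentv 0) (flexv x).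
Proof.
have [c c0 ->] := flexP w x; rewrite /ratio !meval_linv !dotZr.
by rewrite -mulf_div divff // mul1r.
Qed.

Lemma evaluable_tangent a x : x != a -> x != 0 ->
  evaluable (linv (tangentv a)) (linv (tangentv 0)) (flex x).
Proof.
have [c c0 E] := flexP w x.
have H b : x != b -> ~ on (linv (tangentv b)) (flex x).
  move=> xb h; have := tangent_flex_eq0 char0 w2 p0 d0 b x.
  rewrite E dotZr -meval_linv h mulr0 eqxx eq_sym => /esym.
  by rewrite (negPf xb).
by move=> xa x0; split; apply: H.
Qed.

(** The function with divisor 3 (P) - 3 (O) is the quotient of the flexional
    tangents at P and O. For the auxiliary point S another inflection point
    will do, so that only values of tangents at inflection points occur; the
    factors that depend on p and q cancel. *)
Lemma weil_hesse a b : weil3 F (flex 0) (flex a) (flex b) (w ^+ symp a b).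
Proof.
have [s /and5P[s0 sa sb sab /eqP U]] := weil_shift_exists a b.
exists (linv (tangentv a)), (linv (tangentv 0)), (linv (tangentv b)), (linv (tangentv 0)).
exists (flex s), (flex (- s)), (flex (b + s)), (flex (a - s)).
have addF := add_flexP char0 w2 p0 d0.
have bs0 : b + s != 0 by rewrite addrC addr_eq0.
have bsa : b + s != a by rewrite addrC eq_sym -subr_eq eq_sym.
have as0 : a - s != 0 by rewrite subr_eq0 eq_sym.
have asb : a - s != b by rewrite subr_eq eq_sym.
have s0' : - s != 0 by rewrite oppr_eq0.
have sb' : - s != b by rewrite eqr_oppLR.
split.
- by split; apply: div_tangent.
- by split; apply/addF; rewrite ?subrr.
- by split; apply: evaluable_tangent.
- by split; apply: evaluable_tangent.
have -> : w ^+ symp a b = uval (weil_unit a b s) by rewrite U /uval mul1r.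
rewrite /weil_unit /= !uval_mul !uval_inv [uval (false, 0)]mulr1 mulr1.
rewrite !ratio_tangent !tau_tangent !subr0.
have tE x y : x = - y -> tau x = uval (parity y) * tau y.
  by move=> ->; apply: tau_parity.
rewrite (tE (- s) s) // (tE (- s - b) (b + s)); last by rewrite opprD addrC.
rewrite (tE (a - s) (s - a)) ?opprB // (tE (a - s - b) (b + s - a)); last first.
  by rewrite opprB opprD addrA addrAC.
have t1 : tau (b + s - a) != 0 by rewrite tau_neq0 // subr_eq0.
have t2 : tau (s - a) != 0 by rewrite tau_neq0 // subr_eq0.
have t3 := tau_neq0 bs0; have t4 := tau_neq0 s0.
by field; rewrite !uval_neq0 t1 t2 t3 t4.
Qed.

End Weil.

(** * An equation of the Cayleyan *)

(** The matrix of the alternating form (u, v) |-> det (x, u, v). *)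
Definition cross_mx (R : pzRingType) (x : 'rV[R]_3) : 'M[R]_3 :=
  \matrix_(i, j) if j == i + 1 then x 0 (i + 2%:R) else
                 if j == i + 2%:R then - x 0 (i + 1) else 0.

Lemma cross_mx_congr (R : comNzRingType) (A : 'M[R]_3) (y : 'rV[R]_3) :
  A^T *m cross_mx (y *m A^T) *m A = \det A *: cross_mx y.
Proof.
apply/matrixP => i j; rewrite !mulmx3 [RHS]mxE det3.
rewrite !(fun i j => mxE _ _ i j) /= !I3E !sum3 !mxE.
by case: (ord3P i) => ->; case: (ord3P j) => ->; rewrite /= ?I3E; ring.
Qed.

(** The third derivatives of a cubic form are constant; evaluation at 0
    makes them elements of R. *)
Definition cubic_form (R : comNzRingType) (F : {mpoly R[3]}) (i : 'I_3) : 'M[R]_3 :=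
  \matrix_(j, k) (F^`M(i))^`M(j)^`M(k).@[fun=> 0].

Definition trilinear_trace (R : comNzRingType) (S : 'I_3 -> 'M[R]_3)
    (L : 'M[R]_3) i j k : R :=
  \tr (S i *m L *m (S j *m L) *m (S k *m L)).

Definition varrow (R : comNzRingType) : 'rV[{mpoly R[3]}]_3 := \row_i 'X_i.

(** The Cayleyan consists of the lines that are contained in some conic of
    the net of polars, i.e. on which the three conics F_i = 0 induce
    linearly dependent binary quadratic forms. The determinant of those
    forms is, up to a constant, this trace: if J is the matrix of the
    alternating form on the line, the determinant of three symmetric 2 x 2
    matrices Q_i is a multiple of tr (Q_0 J Q_1 J Q_2 J). Written so, it is
    a polynomial in the coefficients of F and its behaviour under linear
    substitutions is visible. *)
Definition cay (R : comNzRingType) (F : {mpoly R[3]}) : {mpoly R[3]} :=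
  trilinear_trace (fun i => map_mx (@mpolyC 3 R) (cubic_form F i))
    (cross_mx (varrow R)) 0 1 2%:R.

Section Alternating.
Variable R : comNzRingType.
Variables (S : 'I_3 -> 'M[R]_3) (L : 'M[R]_3).
Notation T := (trilinear_trace S L).

Lemma trilinear_trace_rot i j k : T i j k = T j k i.
Proof. by rewrite /trilinear_trace -mulmxA mxtrace_mulC. Qed.

Hypothesis symS : forall i, (S i)^T = S i.
Hypothesis altL : L^T = - L.

(** Transposition reverses the order of the factors, and each of the three
    factors L changes sign. *)
Lemma trilinear_trace_swap i j k : T i j k = - T i k j.
Proof.
rewrite /trilinear_trace -mxtrace_tr !trmx_mul !symS altL.
rewrite !(mulNmx, mulmxN, opprK) raddfN /=; congr (- _).
by rewrite !mulmxA mxtrace_mulC !mulmxA.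
Qed.

Hypothesis two_reg : forall x : R, x *+ 2 = 0 -> x = 0.

Lemma trilinear_trace_alt i k : T i k k = 0.
Proof. by apply: two_reg; rewrite mulr2n {1}trilinear_trace_swap addNr. Qed.

(** The trace is alternating in the three symmetric matrices. *)
Lemma trilinear_trace_det (B : 'M[R]_3) :
  trilinear_trace (fun i => \sum_a B i a *: S a) L 0 1 2%:R = \det B * T 0 1 2%:R.
Proof.
have E : trilinear_trace (fun i => \sum_a B i a *: S a) L 0 1 2%:R =
    \sum_a \sum_b \sum_c B 0 a * B 1 b * B 2%:R c * T a b c.
  rewrite /trilinear_trace !mulmx_suml raddf_sum; apply: eq_bigr => a _.
  rewrite /= [X in \tr (X *m _)]mulmx_sumr mulmx_suml raddf_sum; apply: eq_bigr => b _ /=.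
  rewrite mulmx_sumr raddf_sum; apply: eq_bigr => c _ /=.
  rewrite -!(scalemxAl, scalemxAr) !mxtraceZ.
  by ring.
have r1 i k : T k i k = 0.
  rewrite trilinear_trace_swap trilinear_trace_rot trilinear_trace_rot.
  by rewrite trilinear_trace_alt oppr0.
have r2 i k : T k k i = 0 by rewrite trilinear_trace_rot r1.
rewrite E !sum3 det3 !trilinear_trace_alt !r1 !r2.
rewrite (trilinear_trace_swap 0 2%:R 1) (trilinear_trace_swap 1 0 2%:R)
  (trilinear_trace_swap 2%:R 1 0).
rewrite -(trilinear_trace_rot 0 1 2%:R) -(trilinear_trace_rot 1 2%:R 0)
  -(trilinear_trace_rot 0 1 2%:R).
by ring.
Qed.

End Alternating.

Lemma trilinear_trace_ext (R : comNzRingType) (S S' : 'I_3 -> 'M[R]_3) L i j k :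
  S =1 S' -> trilinear_trace S L i j k = trilinear_trace S' L i j k.
Proof. by rewrite /trilinear_trace => E; rewrite !E. Qed.

Lemma congr_mx_sym (R : comNzRingType) (A S : 'M[R]_3) :
  S^T = S -> (A *m S *m A^T)^T = A *m S *m A^T.
Proof. by move=> symS; rewrite !trmx_mul trmxK symS mulmxA. Qed.

Lemma trilinear_trace_scale (R : comNzRingType) (S : 'I_3 -> 'M[R]_3) L d i j k :
  trilinear_trace S (d *: L) i j k = d ^+ 3 * trilinear_trace S L i j k.
Proof. by rewrite /trilinear_trace -!(scalemxAl, scalemxAr) !mxtraceZ; ring. Qed.

Lemma trilinear_trace_congr (R : comNzRingType) (S : 'I_3 -> 'M[R]_3) L A i j k :
  trilinear_trace (fun i => A *m S i *m A^T) L i j k =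
  trilinear_trace S (A^T *m L *m A) i j k.
Proof. by rewrite /trilinear_trace !mulmxA [RHS]mxtrace_mulC !mulmxA. Qed.

Lemma trilinear_trace_map (R R' : comNzRingType) (f : {rmorphism R -> R'})
    (S : 'I_3 -> 'M[R]_3) L i j k :
  f (trilinear_trace S L i j k) =
  trilinear_trace (fun i => map_mx f (S i)) (map_mx f L) i j k.
Proof. by rewrite /trilinear_trace -!map_mxM trace_map_mx. Qed.

Lemma map_cross_mx (R R' : comNzRingType) (f : {rmorphism R -> R'}) (x : 'rV[R]_3) :
  map_mx f (cross_mx x) = cross_mx (map_mx f x).
Proof.
by apply/matrixP => i j; rewrite !mxE; case: ifP => // _; case: ifP => _;
  rewrite ?rmorphN ?rmorph0.
Qed.

Definition hesse_tensor (R : comNzRingType) (P q : R) (i : 'I_3) : 'M[R]_3 :=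
  \matrix_(j, k) if j == i then (if k == i then P else 0)
    else if (k != i) && (k != j) then q else 0.

Lemma trilinear_trace_hesse (R : comNzRingType) (P q : R) (x : 'rV[R]_3) :
  trilinear_trace (hesse_tensor P q) (cross_mx x) 0 1 2%:R =
  P ^+ 2 * q * (x 0 0 ^+ 3 + x 0 1 ^+ 3 + x 0 2%:R ^+ 3)
  + (P ^+ 3 - 4%:R * q ^+ 3) * (x 0 0 * x 0 1 * x 0 2%:R).
Proof.
rewrite /trilinear_trace /mxtrace sum3 !mulmx3 !mxE /= !I3E.
by ring.
Qed.

Section Covariance.
Variable K : fieldType.
Hypothesis char0 : [pchar K] =i pred0.
Implicit Types (F : {mpoly K[3]}) (A : 'M[K]_3) (p q : K).

Lemma cubic_form_pull A F i :
  cubic_form (pull A F) i = \sum_a A i a *: (A *m cubic_form F a *m A^T).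
Proof.
have ev0 G : (pull A G).@[fun=> 0] = G.@[fun=> 0].
  rewrite /meval (mmap_pull idfun); apply: mmap_ext => j.
  by rewrite big1 // => m _; rewrite mulr0.
have d2 G j k : ((pull A G)^`M(j))^`M(k).@[fun=> 0] =
    \sum_b A j b * \sum_c A k c * ((G^`M(b))^`M(c)).@[fun=> 0].
  rewrite mderiv_pull mderiv_sum raddf_sum; apply: eq_bigr => b _.
  rewrite /= mderivZ mevalZ mderiv_pull raddf_sum /=; congr (_ * _).
  by apply: eq_bigr => c _; rewrite mevalZ ev0.
apply/matrixP => j k; rewrite summxE mxE mderiv_pull !mderiv_sum raddf_sum.
apply: eq_bigr => a _; rewrite /= mxE !mderivZ mevalZ; congr (_ * _).
rewrite d2 !sum3 !mulmx3 !mxE; move: (cubic_form F a) => N.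
by ring.
Qed.

(** Three of the factors det A come from A^T L A, which is det A times
    [cross_mx] of the transformed line, and the fourth from
    [trilinear_trace_det]. *)
Lemma cay_pull A F : A \in unitmx ->
  cay (pull A F) = (\det A ^+ 4) *: pull (dual_mx A) (cay F).
Proof.
move=> uA; rewrite /cay.
pose Ap := map_mx (@mpolyC 3 K) A.
pose S i := map_mx (@mpolyC 3 K) (cubic_form F i).
pose y := varrow K *m map_mx (@mpolyC 3 K) (dual_mx A).
have -> : trilinear_trace (fun i => map_mx (@mpolyC 3 K) (cubic_form (pull A F) i))
    (cross_mx (varrow K)) 0 1 2%:R =
    trilinear_trace (fun i => \sum_a Ap i a *: (Ap *m S a *m Ap^T))
    (cross_mx (varrow K)) 0 1 2%:R.
  have E i : map_mx (@mpolyC 3 K) (cubic_form (pull A F) i) =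
      \sum_a Ap i a *: (Ap *m S a *m Ap^T).
    rewrite cubic_form_pull raddf_sum; apply: eq_bigr => a _ /=.
    by rewrite map_mxZ !map_mxM map_trmx mxE.
  exact: trilinear_trace_ext.
rewrite trilinear_trace_det; first last.
- by move=> x /eqP; rewrite -mulr_natl mulf_eq0 -mpolyC_nat mpolyC_eq0
    (negPf (natK char0 1)) => /eqP.
- apply/matrixP => i j; rewrite !mxE.
  by case: (ord3P i) => ->; case: (ord3P j) => ->; rewrite /= ?opprK ?oppr0.
- move=> i; apply: congr_mx_sym.
  by apply/matrixP => j k; rewrite !mxE mderiv_comm.
rewrite trilinear_trace_congr.
have Ey : varrow K = y *m Ap^T.
  rewrite /y /Ap -mulmxA /dual_mx -map_trmx -trmx_mul -map_mxM mulmxV //.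
  by rewrite map_mx1 trmx1 mulmx1.
rewrite [in LHS]Ey cross_mx_congr trilinear_trace_scale mulrA -exprS det_map_mx.
rewrite -rmorphXn /=.
rewrite mul_mpolyC; congr (_ *: _); rewrite (trilinear_trace_map (pull (dual_mx A))).
rewrite map_cross_mx (_ : map_mx _ (varrow K) = y); last first.
  apply/rowP => j; rewrite !mxE /= pullX.
  by apply: eq_bigr => i _; rewrite !mxE -mul_mpolyC mulrC.
apply: trilinear_trace_ext => i.
by apply/matrixP => j k; rewrite !mxE /= pullC.
Qed.

Lemma cay_hesse p q : cay (hesse p q) =
  hesse (36%:R * p ^+ 2 * q) (216%:R * p ^+ 3 - 4%:R * q ^+ 3).
Proof.
have E i : map_mx (@mpolyC 3 K) (cubic_form (hesse p q) i) =
    hesse_tensor (6%:R * p)%:MP q%:MP i.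
  apply/matrixP => j k; rewrite !mxE mderiv2_hesse.
  case: (ord3_cycP i j) => ->; case: (ord3_cycP i k) => ->;
    rewrite !cycE ?eqxx mderiv_mulC mderivXU mevalM !mevalC ?cycE ?eqxx;
    by rewrite ?mulr1 ?mulr0 ?mpolyC0 ?mpolyCM ?mpolyC_nat.
rewrite /cay (trilinear_trace_ext _ _ _ _ E) trilinear_trace_hesse.
rewrite /hesse sum3 prod3 !mxE.
by ring.
Qed.

End Covariance.

Lemma cay_map (R S : comNzRingType) (f : {rmorphism R -> S}) F :
  map_mpoly f (cay F) = cay (map_mpoly f F).
Proof.
rewrite /cay (trilinear_trace_map (map_mpoly f)) map_cross_mx.
have -> : map_mx (map_mpoly f) (varrow R) = varrow S.
  by apply/rowP => i; rewrite !mxE /= map_mpolyX.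
apply: trilinear_trace_ext => i; apply/matrixP => j k.
rewrite !mxE /= map_mpolyC !map_mpoly_mderiv; congr (mpolyC _ _).
apply: etrans (esym (meval_map_mpoly f _ _)) _.
by apply: meval_eq => m /=; rewrite rmorph0.
Qed.

(** * Polar conics and the Cayleyan in the Hesse pencil *)

Section Polars.
Variable K : fieldType.
Hypothesis char0 : [pchar K] =i pred0.
Variable w : K.
Hypothesis w2 : w ^+ 2 + w + 1 = 0.
Variables p q : K.
Hypothesis p0 : p != 0.
Hypothesis d0 : 27%:R * p ^+ 3 + q ^+ 3 != 0.
Implicit Types (u v : 'rV[K]_3) (P Q R S X l : proj2 K) (a b : 'I_3 * 'I_3).

Notation F := (hesse p q).
Notation flex := (@flex K w).
Notation flexv := (@flexv K w).
Notation tangentv := (@tangentv K w p q).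

(** In dual coordinates the harmonic polars are again the nine points
    [flexv], but with each cube root of unity inverted. *)
Definition conj_idx (a : 'I_3 * 'I_3) : 'I_3 * 'I_3 := (a.1, - a.2).

(** The second factor is the harmonic polar of the inflection point. *)
Lemma polar_flexv a : \sum_i flexv a 0 i *: F^`M(i) =
  linv (tangentv a) * linv (flexv (conj_idx a)).
Proof.
have e3 : (w ^+ a.2)%:MP ^+ 3 = 1 :> {mpoly K[3]}.
  by rewrite -rmorphXn /= (pow_w3 w2).
have inv : w ^+ (- a.2)%R = (w ^+ a.2) ^+ 2.
  apply: (mulfI (pow_w_neq0 char0 w2 a.2)).
  by rewrite -(pow_w_add w2) subrr -exprS (pow_w3 w2).
rewrite /linv !(sum3_cyc _ a.1) !flexvE !tangentvE.
rewrite -[(conj_idx a).2]/(- a.2) inv !mderiv_hesse !cycE -!mul_mpolyC.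
move: (w ^+ a.2) e3 => e e3.
apply: (lin_comb1 (c := 3%:R * p%:MP * e%:MP * 'X_(a.1 + 2%:R) ^+ 2
  - q%:MP * 'X_(a.1) * 'X_(a.1 + 2%:R)) e3).
by ring.
Qed.

Lemma polarE P x : (polar F P).@[x] = \sum_i P 0 i * F^`M(i).@[x].
Proof. by rewrite raddf_sum; apply: eq_bigr => i _; rewrite /= mevalZ. Qed.

Definition flex_tangent a := nrm (tangentv a).

Lemma polar_flex a : exists2 c, c != 0 &
  polar F (flex a) = c *: (lin (flex_tangent a) * lin (flex (conj_idx a))).
Proof.
have [c c0 Ec] := flexP w a; have [d d0' Ed] := flexP w (conj_idx a).
have [e e0 Ee] := nrmP (tangentv_neq0 char0 w q p0 a).
exists (c^-1 * (e * d)); first by rewrite !mulf_neq0 ?invr_eq0.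
have -> : polar F (flex a) = c^-1 *: \sum_i flexv a 0 i *: F^`M(i).
  rewrite scaler_sumr; apply: eq_bigr => i _.
  by rewrite Ec mxE !scalerA mulrA mulVf // mul1r.
rewrite polar_flexv {1}Ee {1}Ed !linvZ -!scalerAl -!scalerAr !scalerA.
by rewrite mulrA.
Qed.

Lemma flex_not_on_harmonic a : ~ on (lin (flex (conj_idx a))) (flex a).
Proof.
have [c c0 Ec] := flexP w a; have [d d0' Ed] := flexP w (conj_idx a).
rewrite /on meval_linv => h.
have : dot (flexv (conj_idx a)) (flexv a) = 0.
  by rewrite Ec Ed dotZl dotZr h !mulr0.
have inv : w ^+ (- a.2)%R * w ^+ a.2 = 1 by rewrite -(pow_w_add w2) addNr.
rewrite /dot (sum3_cyc _ a.1) !flexvE -[(conj_idx a).2]/(- a.2) mulrNN inv.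
rewrite mul0r add0r mulr1 => /eqP.
by rewrite (negPf (natK char0 1)).
Qed.

Lemma flex_on_tangent a : on (lin (flex_tangent a)) (flex a).
Proof.
have [c c0 Ec] := flexP w a; have [e e0 Ee] := nrmP (tangentv_neq0 char0 w q p0 a).
have : dot (tangentv a) (flexv a) = 0.
  by apply/eqP; rewrite (tangent_flex_eq0 char0 w2 p0 d0).
rewrite Ec Ee dotZl dotZr /on meval_linv => /eqP.
by rewrite !mulf_eq0 (negPf c0) (negPf e0) => /eqP.
Qed.

Lemma on_hessian_flex a : on (hessian F) (flex a).
Proof.
apply: (inflection_hessian char0 p0 d0).
exact: (inflection_hesseP char0 w2 p0 d0 _).2 (ex_intro _ a erefl).
Qed.

(** The image under iota of an inflection point is the singular point of its
    polar conic, where the flexional tangent meets the harmonic polar; hence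
    the line eta(P) is the flexional tangent. *)
Lemma is_eta_flex a : is_eta F (flex a) (flex_tangent a).
Proof.
split; first exact: on_hessian_flex.
set t := flex_tangent a; set h := flex (conj_idx a).
have th : t <> h.
  by move=> E; apply: (@flex_not_on_harmonic a); rewrite -/h -E; apply: flex_on_tangent.
have c0 := proj2_cross th; have [e e0 Ee] := nrmP c0.
have ont l : dot (l : 'rV_3) (cross t h) = 0 -> on (lin l) (nrm (cross t h)).
  rewrite {1}Ee dotZr /on meval_linv => /eqP.
  by rewrite mulf_eq0 (negPf e0) => /eqP.
exists (nrm (cross t h)); split; first 1 last.
- exact: flex_on_tangent.
- by apply: ont; rewrite dotC dot_crossl.
rewrite /is_iota; have [c c0' ->] := polar_flex a.
apply/(singular_pointZ _ _ c0'); apply: singular_pointM; apply: ont.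
  by rewrite dotC dot_crossl.
by rewrite dotC dot_crossr.
Qed.

(** An inflection point P also has order dividing 3 on the Hessian, so -2P =
    P and the conic to be split is the polar of P itself. *)
Lemma is_iota'_flex a : nonsingular_cubic (hessian F) ->
  is_iota' F (flex 0) (flex_tangent a) (flex (conj_idx a)).
Proof.
rewrite hessian_hesse => /(nonsingular_hesseP char0)[p0' d0'].
have addH := add_flexP char0 w2 p0' d0'.
exists (flex a), (flex (a + a)), (flex a); split.
- exact: is_eta_flex.
- by rewrite hessian_hesse; apply/addH.
- by rewrite hessian_hesse; apply/addH; rewrite -{3}(neg_addxx a) subrr.
- exact: polar_flex.
Qed.

Lemma is_iota_hesseP P Q : is_iota F P Q <-> polarv p q P Q = 0.
Proof.
have dE i : (polar F P)^`M(i).@[Q 0] = polarv p q P Q 0 i.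
  rewrite /polar mderiv_sum raddf_sum polarvC -dot_grad_mderiv.
  by apply: eq_bigr => j _; rewrite /= mderivZ mevalZ !mxE mderiv_comm mulrC.
split=> [[_ h]|h].
  by apply/rowP => i; rewrite -dE mxE; apply: h.
split=> [|i]; last by rewrite /on dE h mxE.
apply: (mulfI (natK char0 1)); rewrite mulr0 polarE.
have -> : \sum_i P 0 i * F^`M(i).@[Q 0] = dot P (grad F Q).
  by apply: eq_bigr => i _; rewrite mxE.
by rewrite -dotZr -polarv_diag dotC dot_polarvC polarvC h dotE !mxE !mul0r !addr0.
Qed.

Definition net_mx u v : 'M[K]_3 := \matrix_(i, j)
  (if i == 0 then polarv p q u u else
   if i == 1 then polarv p q u v else polarv p q v v) 0 j.

(** Column j contains the values at (u, u), (u, v) and (v, v) of the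
    symmetric bilinear form of the conic F_j = 0, so that this is the
    determinant of three binary quadratic forms on the line spanned by u and
    v. *)
Lemma det_net u v : \det (net_mx u v) = - (cay F).@[cross u v 0].
Proof.
rewrite cay_hesse (meval_hesse _ _ _ 0) det3 !I3E /cross !vec3E !mxE /= !I3E.
by ring.
Qed.

End Polars.

Section Cayleyan.
Variable K : closedFieldType.
Hypothesis char0 : [pchar K] =i pred0.
Variables p q : K.
Hypothesis p0 : p != 0.
Hypothesis d0 : 27%:R * p ^+ 3 + q ^+ 3 != 0.
Implicit Types (u v : 'rV[K]_3) (l : proj2 K).

Notation F := (hesse p q).

Lemma closed_quadratic (a b c : K) : a != 0 -> exists x, a * x ^+ 2 - b * x + c = 0.
Proof.
move=> a0.
have := @solve_monicpoly K 2 (fun i => if i == 0%N then - c / a else b / a) isT.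
case=> x; rewrite !big_ord_recl big_ord0 /= expr0 expr1 => E; exists x.
rewrite E; by field.
Qed.

(** Over an algebraically closed field the symmetric tensor with coefficients
    x, y, z is the symmetric product of two vectors, as a binary quadratic form
    is a product of linear forms. *)
Lemma polarv_factor (x y z : K) u v : (x, y, z) != (0, 0, 0) -> cross u v != 0 ->
  x *: polarv p q u u + y *: polarv p q u v + z *: polarv p q v v = 0 ->
  exists a b a' b', [/\ (a, b) != (0, 0), (a', b') != (0, 0) &
    polarv p q (a *: u + b *: v) (a' *: u + b' *: v) = 0].
Proof.
move=> xyz uv E.
have comb a b a' b' : polarv p q (a *: u + b *: v) (a' *: u + b' *: v) =
    (a * a') *: polarv p q u u + (a * b' + b * a') *: polarv p q u v
    + (b * b') *: polarv p q v v.
  by apply/rowP => i; rewrite !mxE; ring.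
case: (eqVneq x 0) => [x0|x0].
  exists 0, 1, y, z; split.
  - by rewrite xpair_eqE oner_eq0 andbF.
  - by move: xyz; rewrite x0 !xpair_eqE eqxx.
  - by rewrite comb -[RHS]E x0 !mul0r !mul1r add0r.
have [t Et] := closed_quadratic y z x0.
exists 1, t, x, (y - x * t); split.
- by rewrite xpair_eqE oner_eq0.
- by rewrite xpair_eqE (negPf x0).
rewrite comb -[RHS]E; congr (_ *: _ + _ *: _ + _ *: _); try by ring.
by apply: (lin_comb1 (c := - 1) Et); ring.
Qed.

Lemma comb_neq0 u v (a b : K) : cross u v != 0 -> (a, b) != (0, 0) ->
  a *: u + b *: v != 0.
Proof.
move=> uv; apply: contra => /eqP E.
have Ea : a *: cross u v = 0.
  transitivity (cross (a *: u + b *: v) v); last first.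
    by rewrite E; apply: row3P; rewrite /cross vec3E !mxE; ring.
  by apply: row3P; rewrite /cross !vec3E !mxE /=; ring.
have Eb : b *: cross u v = 0.
  transitivity (cross u (a *: u + b *: v)); last first.
    by rewrite E; apply: row3P; rewrite /cross vec3E !mxE; ring.
  by apply: row3P; rewrite /cross !vec3E !mxE /=; ring.
move/eqP: Ea; move/eqP: Eb; rewrite !scaler_eq0 (negPf uv) !orbF => /eqP -> /eqP ->.
exact: eqxx.
Qed.

(** If the determinant of [net_mx] is 0, some symmetric tensor of the plane
    spanned by u and v is annihilated by F''. It is a product of two vectors
    a and b, and F''(a) b = 0 says that a lies on the Hessian and b =
    iota(a). Conversely a and iota(a) are different and span the plane, and
    then the middle row of [net_mx] is 0. *)
Lemma cayleyan_hesseP l : on (cay F) l <-> cayleyan F l.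
Proof.
rewrite cay_hesse; set C := hesse _ _; have hC : C \is 3.-homog := hesse_homog _ _.
have netC u v : \det (net_mx p q u v) = - C.@[cross u v 0] by rewrite det_net cay_hesse.
split=> [Cl|[P [hP [Q [PQ lP lQ]]]]].
  have [u [v [uv [c c0 lE]]]] := line_basis (proj2_neq0 l).
  have /eqP/det0P[x x0 xE] : \det (net_mx p q u v) = 0.
    rewrite netC; move: Cl; rewrite /on lE (meval_homog _ _ hC) => /eqP.
    by rewrite mulf_eq0 expf_eq0 (negPf c0) => /eqP ->; rewrite oppr0.
  have [||a [b [a' [b' [ab ab' E]]]]] :=
    @polarv_factor (x 0 0) (x 0 1) (x 0 2%:R) u v _ uv.
  - apply: contra x0 => /eqP[x0 x1 x2]; apply/eqP/row3P; by rewrite ?x0 ?x1 ?x2 mxE.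
  - by apply/rowP => j; move/rowP/(_ j): xE; rewrite mulmx3 !mxE.
  have n0 := comb_neq0 uv ab; have n0' := comb_neq0 uv ab'.
  have [e e0 Ee] := nrmP n0; have [f f0 Ef] := nrmP n0'.
  move: E; rewrite {1}Ee {1}Ef polarvZr polarvC polarvZr => /eqP.
  rewrite !scaler_eq0 (negPf e0) (negPf f0) /= => /eqP; rewrite polarvC => PQ.
  have onl y z : y *: u + z *: v != 0 ->
      on (lin l) (nrm (y *: u + z *: v)).
    move=> yz0; have [g g0 Eg] := nrmP yz0; rewrite /on meval_linv.
    have : dot l (y *: u + z *: v) = 0.
      by rewrite lE dotZl dotDr !dotZr dot_crossl dot_crossr !mulr0 addr0 mulr0.
    by rewrite {1}Eg dotZr => /eqP; rewrite mulf_eq0 (negPf g0) => /eqP.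
  exists (nrm (a *: u + b *: v)); split.
    exact: hessian_ker (proj2_neq0 _) PQ.
  exists (nrm (a' *: u + b' *: v)); split.
  - exact/is_iota_hesseP.
  - exact: onl.
  - exact: onl.
have PQE := (is_iota_hesseP char0 p q P Q).1 PQ.
have nPQ : P <> Q.
  move=> E; move: PQE; rewrite -E polarv_diag => /eqP.
  by rewrite scaler_eq0 (negPf (natK char0 1)) (negPf (grad_neq0 char0 p0 d0 P)).
have c0 := proj2_cross nPQ.
rewrite /on !meval_linv in lP lQ; have [c lE] := perp2 c0 lP lQ.
rewrite /on lE (meval_homog _ _ hC) -[C.@[_]]opprK -netC.
have -> : \det (net_mx p q P Q) = 0; last by rewrite oppr0 mulr0.
have row1 j : net_mx p q P Q 1 j = 0 by rewrite mxE /= PQE mxE.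
by rewrite det3 !row1; ring.
Qed.

End Cayleyan.

(** * Ternary cubic forms *)

Section CubicForms.
Variable K : fieldType.
Implicit Types (F G : {mpoly K[3]}) (v : 'rV[K]_3) (P : proj2 K).

Notation x := ('X_0 : {mpoly K[3]}).
Notation y := ('X_1 : {mpoly K[3]}).
Notation z := ('X_(2%:R) : {mpoly K[3]}).

Definition quadric (c0 c1 c2 c3 c4 c5 : K) : {mpoly K[3]} :=
  c0%:MP * (x * x) + c1%:MP * (x * y) + c2%:MP * (x * z)
  + c3%:MP * (y * y) + c4%:MP * (y * z) + c5%:MP * (z * z).

Definition cubic (a0 a1 a2 a3 a4 a5 a6 a7 a8 a9 : K) : {mpoly K[3]} :=
  a0%:MP * (x * x * x) + a1%:MP * (x * x * y) + a2%:MP * (x * x * z)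
  + a3%:MP * (x * y * y) + a4%:MP * (x * y * z) + a5%:MP * (x * z * z)
  + a6%:MP * (y * y * y) + a7%:MP * (y * y * z) + a8%:MP * (y * z * z)
  + a9%:MP * (z * z * z).

Lemma cubic_exists F : F \is 3.-homog ->
  exists k : nat -> nat -> K, F = cubic (k 3 0) (k 2 1) (k 2 0) (k 1 2) (k 1 1)
    (k 1 0) (k 0 3) (k 0 2) (k 0 1) (k 0 0).
Proof.
move=> /dhomogP hF; rewrite (mpolyE F) big_seq.
elim/big_rec: _ => [|m G /hF /= dm [k ->]].
- by exists (fun _ _ => 0); rewrite /cubic; ring.
exists (fun i j => (if (i == m 0) && (j == m 1) then F@_m else 0) + k i j).
move: dm; rewrite mdegE mpolyXE_id sum3 prod3 -mul_mpolyC /cubic.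
by case: (m 0) => [|[|[|[|?]]]] //=; case: (m 1) => [|[|[|[|?]]]] //=;
  case: (m 2%:R) => [|[|[|[|?]]]] //= _; ring.
Qed.

Lemma mderiv_quadric c0 c1 c2 c3 c4 c5 (Q := quadric c0 c1 c2 c3 c4 c5) :
  (Q^`M(0) = linv (vec3 (2%:R * c0) c1 c2)) * (Q^`M(1) = linv (vec3 c1 (2%:R * c3) c4))
  * (Q^`M(2%:R) = linv (vec3 c2 c4 (2%:R * c5))).
Proof.
rewrite /Q /quadric /linv !sum3 !vec3E !(mderivD, mderiv_mulC) !mderivM !mderivXU /=.
rewrite -!mul_mpolyC.
by split; [split|]; ring.
Qed.

Lemma grad_quadric c0 c1 c2 c3 c4 c5 v : grad (quadric c0 c1 c2 c3 c4 c5) v =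
  vec3 (2%:R * c0 * v 0 0 + c1 * v 0 1 + c2 * v 0 2%:R)
       (c1 * v 0 0 + 2%:R * c3 * v 0 1 + c4 * v 0 2%:R)
       (c2 * v 0 0 + c4 * v 0 1 + 2%:R * c5 * v 0 2%:R).
Proof.
by apply: row3P; rewrite mxE mderiv_quadric meval_linv dotE !vec3E.
Qed.

Lemma mderiv_cubic a0 a1 a2 a3 a4 a5 a6 a7 a8 a9
    (C := cubic a0 a1 a2 a3 a4 a5 a6 a7 a8 a9) :
  (C^`M(0) = quadric (3%:R * a0) (2%:R * a1) (2%:R * a2) a3 a4 a5)
  * (C^`M(1) = quadric a1 (2%:R * a3) a4 (3%:R * a6) (2%:R * a7) a8)
  * (C^`M(2%:R) = quadric a2 a4 (2%:R * a5) a7 (2%:R * a8) (3%:R * a9)).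
Proof.
rewrite /C /quadric /cubic !(mderivD, mderiv_mulC) !mderivM !mderivXU /=.
by split; [split|]; ring.
Qed.

Lemma meval_quadric c0 c1 c2 c3 c4 c5 v : (quadric c0 c1 c2 c3 c4 c5).@[v 0] =
  c0 * (v 0 0 * v 0 0) + c1 * (v 0 0 * v 0 1) + c2 * (v 0 0 * v 0 2%:R)
  + c3 * (v 0 1 * v 0 1) + c4 * (v 0 1 * v 0 2%:R) + c5 * (v 0 2%:R * v 0 2%:R).
Proof. by rewrite /quadric !(mevalD, mevalM, mevalC, mevalXU). Qed.

Lemma meval_cubic a0 a1 a2 a3 a4 a5 a6 a7 a8 a9 v :
  (cubic a0 a1 a2 a3 a4 a5 a6 a7 a8 a9).@[v 0] =
  a0 * v 0 0 ^+ 3 + a1 * v 0 0 ^+ 2 * v 0 1 + a2 * v 0 0 ^+ 2 * v 0 2%:R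
  + a3 * v 0 0 * v 0 1 ^+ 2 + a4 * v 0 0 * v 0 1 * v 0 2%:R + a5 * v 0 0 * v 0 2%:R ^+ 2
  + a6 * v 0 1 ^+ 3 + a7 * v 0 1 ^+ 2 * v 0 2%:R + a8 * v 0 1 * v 0 2%:R ^+ 2
  + a9 * v 0 2%:R ^+ 3.
Proof. by rewrite /cubic !(mevalD, mevalM, mevalC, mevalXU); ring. Qed.

Lemma cubic_homog a0 a1 a2 a3 a4 a5 a6 a7 a8 a9 :
  cubic a0 a1 a2 a3 a4 a5 a6 a7 a8 a9 \is 3.-homog.
Proof.
have h i : ('X_i : {mpoly K[3]}) \is 1.-homog for mdeg by rewrite dhomogX /= mdeg1.
have h3 (c : K) (i j k : 'I_3) :
    (c%:MP * ('X_i * 'X_j * 'X_k) : {mpoly K[3]}) \is 3.-homog for mdeg.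
  by rewrite mul_mpolyC; apply: rpredZ; apply: (dhomogM (dhomogM (h i) (h j)) (h k)).
by rewrite /cubic !rpredD.
Qed.

Lemma singular_nrm d F v : F \is d.+1.-homog -> v != 0 -> F.@[v 0] = 0 ->
  (forall i, F^`M(i).@[v 0] = 0) -> singular_point F (nrm v).
Proof.
move=> hF v0 Fv dFv; have [c c0 E] := nrmP v0.
have H G e : G \is e.-homog -> G.@[v 0] = 0 -> on G (nrm v).
  move=> hG; rewrite {1}E (meval_homog _ _ hG) => /eqP.
  by rewrite mulf_eq0 expf_eq0 (negPf c0) andbF => /eqP.
split; first exact: H hF Fv.
by move=> i; apply: H (mderiv_homog i hF) (dFv i).
Qed.

Definition mx3 (a b c d e f g h i : K) : 'M[K]_3 :=
  \matrix_(m, n) nth 0 (nth [::] [:: [:: a; b; c]; [:: d; e; f]; [:: g; h; i]] m) n.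

Lemma pull_mx3 a b c d e f g h i (M := mx3 a b c d e f g h i) :
  (pull M x = a%:MP * x + d%:MP * y + g%:MP * z) *
  (pull M y = b%:MP * x + e%:MP * y + h%:MP * z) *
  (pull M z = c%:MP * x + f%:MP * y + i%:MP * z).
Proof. by rewrite /M !pullX !sum3 !mxE /= -!mul_mpolyC. Qed.

Lemma pull_cubic M a0 a1 a2 a3 a4 a5 a6 a7 a8 a9 (x' := pull M x) (y' := pull M y)
    (z' := pull M z) :
  pull M (cubic a0 a1 a2 a3 a4 a5 a6 a7 a8 a9) =
  a0%:MP * (x' * x' * x') + a1%:MP * (x' * x' * y') + a2%:MP * (x' * x' * z')
  + a3%:MP * (x' * y' * y') + a4%:MP * (x' * y' * z') + a5%:MP * (x' * z' * z')
  + a6%:MP * (y' * y' * y') + a7%:MP * (y' * y' * z') + a8%:MP * (y' * z' * z')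
  + a9%:MP * (z' * z' * z').
Proof. by rewrite /cubic !pullD !pullM !pullC. Qed.

End CubicForms.

(** * Reduction to the Hesse pencil *)

Section HesseForm.
Variable K : closedFieldType.
Hypothesis char0 : [pchar K] =i pred0.
Implicit Types (F : {mpoly K[3]}) (P O l : proj2 K).

Fact lead_pt1 : lead (vec3 0 1 0 : 'rV[K]_3) == 1.
Proof. by rewrite /lead !vec3E eqxx oner_eq0. Qed.

Definition pt1 : proj2 K := Proj2 lead_pt1.

Lemma mul_vec3_mx3 (x y z a b c d e f g h i : K) :
  vec3 x y z *m mx3 a b c d e f g h i =
  vec3 (x * a + y * d + z * g) (x * b + y * e + z * h) (x * c + y * f + z * i).
Proof. by apply: row3P; rewrite mulmx3 !mxE. Qed.

Lemma det_mx3 (a b c d e f g h i : K) : \det (mx3 a b c d e f g h i) =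
  a * (e * i - f * h) - b * (d * i - f * g) + c * (d * h - e * g).
Proof. by rewrite det3 !mxE. Qed.

(** Coordinates in which the inflection point is (0 : 1 : 0) and its tangent
    is z = 0. *)
Lemma inflection_frame F O l : F \is 3.-homog -> ord_ge F O (lin l) 3 ->
  exists B, [/\ B \in unitmx, act B pt1 = O &
    ord_ge (pull B F) pt1 (linv (vec3 0 0 1)) 3].
Proof.
move=> hF h; have [u [_ [Ou [lO lu _] _ _]]] := ord_ge3_linv h.
have [n ln] := dot1_exists (proj2_neq0 l).
pose B := mx3 (u 0 0) (u 0 1) (u 0 2%:R) (O 0 0) (O 0 1) (O 0 2%:R)
  (n 0 0) (n 0 1) (n 0 2%:R).
have uB : B \in unitmx.
  rewrite unitmxE unitfE det_mx3.
  have [c lE] := perp2 Ou lO lu.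
  apply/eqP => E; have /eqP := ln; rewrite lE dotZl.
  have -> : dot (cross O u) n = 0.
    by rewrite -oppr0 -[X in - X]E dotE /cross !vec3E; ring.
  by rewrite mulr0 eq_sym oner_eq0.
have aB : act B pt1 = O.
  apply: (nrm_eq (oner_neq0 K)); rewrite scale1r [LHS]mul_vec3_mx3.
  by apply: row3P; rewrite vec3E; ring.
exists B; split=> //.
have -> : linv (vec3 0 0 1) = pull B (linv l).
  rewrite pull_linv; congr linv; apply/esym; move: ln lO lu; rewrite !dotE => <- lO lu.
  by apply: row3P; rewrite mulmx3 !mxE /= ?lO ?lu.
by apply/(ord_ge_pull uB _ _ hF (linv_homog _)); rewrite aB.
Qed.

(** The conditions of order 0, 1 and 2 on an arc in the direction of z = 0
    remove y^3, x y^2 and x^2 y. Without x^3 or y^2 z the curve would be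
    singular. *)
Lemma flex_normal_form F : nonsingular_cubic F ->
  ord_ge F pt1 (linv (vec3 0 0 1)) 3 ->
  exists a b c d e f g, [/\ F = cubic a 0 c 0 d e 0 b f g, a != 0 & b != 0].
Proof.
case=> hF ns h.
have {hF} [a0 [a1 [a2 [a3 [a4 [a5 [a6 [a7 [a8 [a9 FE]]]]]]]]]] :
    exists a0 a1 a2 a3 a4 a5 a6 a7 a8 a9, F = cubic a0 a1 a2 a3 a4 a5 a6 a7 a8 a9.
  by have [k FE] := cubic_exists hF; do 10 eexists; exact: FE.
have ptE : (pt1 : 'rV_3) = vec3 0 1 0 by [].
have [v [u [pv [_ lv lu] gv gu]]] := ord_ge3_linv h.
have [Fp _] : on F pt1 /\ on (linv (vec3 0 0 1)) pt1.
  by apply/ord_ge1P; apply: ord_ge_le h.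
have v2 : v 0 2%:R = 0 by move: lv; rewrite dotE !vec3E => <-; ring.
have u2 : u 0 2%:R = 0 by move: lu; rewrite dotE !vec3E => <-; ring.
have v0 : v 0 0 != 0.
  apply: contraNneq pv => v0; apply/eqP.
  by rewrite ptE; apply: row3P; rewrite /cross !vec3E mxE ?v0 ?v2; ring.
have a60 : a6 = 0 by move: Fp; rewrite /on FE meval_cubic ptE !vec3E => <-; ring.
have gE : grad F pt1 = vec3 a3 (3%:R * a6) a7.
  apply: row3P; rewrite mxE FE ?mderiv_cubic meval_quadric ptE !vec3E;
  by ring.
have a30 : a3 = 0.
  apply: (mulIf v0); rewrite mul0r -[RHS]gv gE dotE !vec3E a60 v2.
  by ring.
have a10 : a1 = 0.
  move: gu; rewrite gE sum3 FE !mderiv_cubic !grad_quadric.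
  rewrite !dotE ptE !vec3E u2 v2 a30 a60 => E.
  apply: (mulIf (mulf_neq0 (natK char0 1) (expf_neq0 2 v0))).
  by rewrite mul0r -[RHS]E; ring.
subst a1 a3 a6.
have hF : F \is 3.-homog by rewrite FE; apply: cubic_homog.
have a70 : a7 != 0.
  apply/eqP => a70; apply: (ns pt1); split=> [//|i].
  by move/rowP: gE => /(_ i); rewrite a70 mxE /on => ->;
    case: (ord3P i) => ->; rewrite vec3E ?mulr0.
exists a0, a7, a2, a4, a5, a8, a9; split=> //.
apply/eqP => a00; subst a0.
have [t Et] := closed_quadratic (- a4) a2 a70.
have n0 : vec3 1 t 0 != 0.
  by apply/eqP => /rowP/(_ 0); rewrite vec3E mxE => /eqP; rewrite oner_eq0.
apply: (ns (nrm (vec3 1 t 0))); apply: (singular_nrm hF n0).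
  by rewrite FE meval_cubic !vec3E; ring.
by move=> i; rewrite FE; case: (ord3P i) => ->;
  rewrite mderiv_cubic meval_quadric !vec3E; first [ring | rewrite -[RHS]Et; ring].
Qed.

(** Completing the square in y leaves a form b y^2 z + h(x, z). Then the origin
    of x is moved to a root of h'^2 = 2 h h'', which is the equation of the
    abscissas of the other inflection points. *)
Lemma flex_reduced_form (a b c d e f g : K) : a != 0 -> b != 0 ->
  exists M c' e' g', [/\ M \in unitmx, act M pt1 = pt1,
    e' ^+ 2 = 4%:R * c' * g'
    & cubic a 0 c 0 d e 0 b f g = pull M (cubic a 0 c' 0 0 e' 0 b 0 g')].
Proof.
move=> a0 b0; have n2 := natK char0 1; have n3 := natK char0 2.
pose s := d / (2%:R * b); pose t := f / (2%:R * b).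
have dE : d = 2%:R * b * s by rewrite /s; field; rewrite b0 n2.
have fE : f = 2%:R * b * t by rewrite /t; field; rewrite b0 n2.
pose C := c - b * s ^+ 2; pose E := e - 2%:R * b * s * t; pose G := g - b * t ^+ 2.
have a3 : 3%:R * a ^+ 2 != 0 by rewrite mulf_neq0 ?expf_neq0.
have [x Ex] := @solve_monicpoly K 4 (nth 0
  [:: (E ^+ 2 - 4%:R * C * G) / (3%:R * a ^+ 2); - 12%:R * a * G / (3%:R * a ^+ 2);
      - 6%:R * a * E / (3%:R * a ^+ 2); - 4%:R * a * C / (3%:R * a ^+ 2)]) isT.
move: Ex; rewrite !big_ord_recl big_ord0 /= /bump /= => Ex.
pose c' := 3%:R * a * x + C.
pose e' := 3%:R * a * x ^+ 2 + 2%:R * C * x + E.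
pose g' := a * x ^+ 3 + C * x ^+ 2 + E * x + G.
exists (mx3 1 s 0 0 1 0 (- x) t 1), c', e', g'; split.
- by rewrite unitmxE unitfE det_mx3 (_ : _ - _ + _ = 1) ?oner_eq0 //; ring.
- apply: (nrm_eq (oner_neq0 K)); rewrite scale1r [LHS]mul_vec3_mx3.
  by apply: row3P; rewrite !vec3E; ring.
- apply: (mulfI a3); apply: (lin_comb1 (c := - (3%:R * a ^+ 2) ^+ 2) Ex).
  by rewrite /c' /e' /g'; field; rewrite a0 n3.
rewrite pull_cubic !pull_mx3 /cubic dE fE.
have -> : c = C + b * s ^+ 2 by rewrite /C; ring.
have -> : e = E + 2%:R * b * s * t by rewrite /E; ring.
have -> : g = G + b * t ^+ 2 by rewrite /G; ring.
rewrite /c' /e' /g'; clearbody C E G s t.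
by ring.
Qed.

Lemma nonsingularZ F (c : K) :
  c != 0 -> nonsingular_cubic F -> nonsingular_cubic (c *: F).
Proof.
move=> c0 [hF ns]; split; first exact: rpredZ.
by move=> P /(singular_pointZ _ _ c0) /ns.
Qed.

Lemma singular_cubic_at F (v : 'rV[K]_3) : nonsingular_cubic F -> v != 0 ->
  F.@[v 0] = 0 -> (forall i, F^`M(i).@[v 0] = 0) -> False.
Proof.
by case=> hF ns v0 Fv dFv; apply: (ns (nrm v)); exact: (singular_nrm hF v0 Fv dFv).
Qed.

(** The equation e^2 = 4 c g makes c x^2 + e x z + g z^2 equal to - b times
    the square of a linear form la x + y0 z. If c were 0, the Hessian would
    contain the line x = 0; if y0 were 0, the point (0 : 0 : 1) would be
    singular. *)
Lemma flex_parameters (a b c e g : K) (F := cubic a 0 c 0 0 e 0 b 0 g) :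
  b != 0 -> e ^+ 2 = 4%:R * c * g ->
  nonsingular_cubic F -> nonsingular_cubic (hessian F) ->
  exists la y0, [/\ la != 0, y0 != 0, c = - b * la ^+ 2, e = - 2%:R * b * la * y0
    & g = - b * y0 ^+ 2].
Proof.
move=> b0 ecg ns hns; have n2 := natK char0 1.
have vec1 (x y : K) : vec3 x y 1 != 0.
  by apply/eqP => /rowP/(_ 2%:R); rewrite vec3E mxE => /eqP; rewrite oner_eq0.
have c0 : c != 0.
  apply/eqP => c0; have e0 : e = 0.
    by move/eqP: ecg; rewrite c0 mulr0 mul0r expf_eq0 => /eqP.
  have HE : hessian F = 'X_0 * ((6%:R * a)%:MP * ((2%:R * b)%:MP * (6%:R * g)%:MP *
      ('X_(2%:R) * 'X_(2%:R)) - (2%:R * b)%:MP * (2%:R * b)%:MP * ('X_1 * 'X_1))).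
    have [[D0 D1] D2] := mderiv_cubic a 0 c 0 0 e 0 b 0 g.
    rewrite /hessian det3 !mxE /F D0 D1 D2 !mderiv_quadric /linv !sum3 !vec3E c0 e0.
    by rewrite -!mul_mpolyC; ring.
  have [t Et] := closed_quadratic 0 (- 3%:R * g / b) (oner_neq0 K).
  have [d d0 /rowP Ed] := nrmP (vec1 0 t).
  case: hns => _ /(_ (nrm (vec3 0 t 1))); apply; move: (nrm _) Ed => P Ed.
  have P0 : P 0 0 = 0.
    by have /esym/eqP := Ed 0; rewrite vec3E mxE mulf_eq0 (negPf d0) => /eqP.
  have P1 : P 0 1 = t / d.
    by have := Ed 1; rewrite vec3E mxE => ->; field.
  have P2 : P 0 2%:R = 1 / d.
    by have := Ed 2%:R; rewrite vec3E mxE => ->; field.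
  rewrite HE; apply: singular_pointM; first by rewrite /on mevalXU.
  rewrite /on !(mevalM, mevalB, mevalC, mevalXU) P1 P2.
  apply: (lin_comb1 (c := - 24%:R * a * b ^+ 2 / d ^+ 2) Et).
  by field; rewrite d0 b0.
have [la Ela] := closed_quadratic 0 (c / b) (oner_neq0 K).
have cE : c = - b * la ^+ 2 by apply: (lin_comb1 (c := b) Ela); field.
have la0 : la != 0.
  by apply: contraNneq c0 => la0; rewrite cE la0 expr0n mulr0.
pose y0 := - e / (2%:R * b * la).
have eE : e = - 2%:R * b * la * y0 by rewrite /y0; field; rewrite la0 b0 n2.
have gE : g = - b * y0 ^+ 2.
  have n4 : 4%:R * b * la ^+ 2 != 0 by rewrite !mulf_neq0 ?(natK char0 3) ?expf_neq0.
  apply: (mulfI n4); move: ecg; rewrite eE cE => ecg.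
  by apply: (lin_comb1 (c := 1) ecg); ring.
exists la, y0; split=> //; apply/eqP => y00.
apply: (singular_cubic_at ns (vec1 0 0)).
  by rewrite meval_cubic !vec3E gE y00; ring.
move=> i; case: (ord3P i) => ->; rewrite mderiv_cubic meval_quadric !vec3E;
  by rewrite ?eE ?gE ?y00; ring.
Qed.

(** Put L = la x + y0 z. Then F is a combination of u v w' and (u + v +
    w')^3, where u = 2 y0 z, v = y - L and w' = - y - L are tangents at
    three collinear inflection points and u + v + w' = - 2 la x. The cubic
    with parameters (p, 1) has the same form with respect to its tangents at
    the inflection points on x = 0, scaled by cube roots of unity. Equality
    of the ratios of the two coefficients is an equation for p^3, and its
    right-hand side is not 0 because otherwise the point u = v = w' would be
    singular. *)
Lemma flex_hesse_form (a b la y0 w : K)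
    (F := cubic a 0 (- b * la ^+ 2) 0 0 (- 2%:R * b * la * y0) 0 b 0 (- b * y0 ^+ 2)) :
  b != 0 -> la != 0 -> y0 != 0 -> w ^+ 2 + w + 1 = 0 -> nonsingular_cubic F ->
  exists M p q, [/\ M \in unitmx, act M pt1 = flex w 0 & F = pull M (hesse p q)].
Proof.
move=> b0 la0 y00 w2 ns.
have n2 := natK char0 1; have n3 := natK char0 2; have n54 := natK char0 53.
have n27 := natK char0 26; have n4 := natK char0 3.
have [p Ep] := @solve_monicpoly K 3 (nth 0 [::
  - (1 / 27%:R) - a * y0 / (4%:R * b * la ^+ 3); 0; 0]) isT.
move: Ep; rewrite !big_ord_recl big_ord0 /= !mul0r !addr0 expr0 mulr1 => Ep.
have p0 : p != 0.
  apply/eqP => p0; move: Ep; rewrite p0 expr0n /= => Ep.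
  have aE : 27%:R * a * y0 = - 4%:R * b * la ^+ 3.
    apply: (lin_comb1 (c := 27%:R * (4%:R * b * la ^+ 3)) Ep).
    by field; rewrite n4 la0 b0 n27.
  apply: (@singular_cubic_at _ (vec3 (- 3%:R * y0) 0 la) ns).
  - by apply/eqP => /rowP/(_ 2%:R); rewrite vec3E mxE => /eqP; rewrite (negPf la0).
  - rewrite meval_cubic !vec3E; apply: (lin_comb1 (c := - y0 ^+ 2) aE); ring.
  move=> i; case: (ord3P i) => ->; rewrite mderiv_cubic meval_quadric !vec3E; try ring.
  by apply: (lin_comb1 (c := y0) aE); ring.
pose c := - b / (54%:R * p * y0).
have bE : b = - 54%:R * p * y0 * c by rewrite /c; field; rewrite n54 p0 y00.
have aE : a = 8%:R * (27%:R * p ^+ 3 + 1) * la ^+ 3 * p * c.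
  rewrite /c Ep; field; rewrite n54 p0 y00 n4 la0 b0 n27.
  by [].
pose dl := w - w ^+ 2.
have dl2 : dl ^+ 2 = - 3%:R.
  by apply: (lin_comb1 (c := w ^+ 2 - 3%:R * w + 3%:R) w2); rewrite /dl; ring.
have dl0 : dl != 0.
  by apply: contraNneq n3 => dl0; rewrite -oppr_eq0 -dl2 dl0 expr0n.
exists (mx3 (6%:R * p * la) la la 0 dl (- dl) 0 (3%:R * y0) (3%:R * y0)), (c * p), c.
split.
- rewrite unitmxE unitfE det_mx3.
  rewrite (_ : _ - _ + _ = 36%:R * p * la * y0 * dl); last by ring.
  by rewrite !mulf_neq0 // (natK char0 35).
- rewrite /act /flex [X in nrm X]mul_vec3_mx3 -(nrmZ dl0 (flexv_neq0 w 0)); congr nrm.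
  by apply: row3P; rewrite vec3E !mxE /=; ring.
have -> : hesse (c * p) c = cubic (c * p) 0 0 0 c 0 (c * p) 0 0 (c * p).
  by rewrite /hesse /cubic sum3 prod3; ring.
rewrite pull_cubic !pull_mx3 /F /cubic bE aE.
have {}dl2 : dl%:MP ^+ 2 = - 3%:R :> {mpoly K[3]} by rewrite -rmorphXn /= dl2; ring.
clearbody dl c.
apply: (lin_comb1 (c := 18%:R * (p%:MP * c%:MP) *
  (- y0%:MP * 'X_(2%:R)) * 'X_1 ^+ 2) dl2).
by ring.
Qed.

(** The matrix A is composed of the frame of [inflection_frame] and of the two
    reductions. The hypothesis on the Hessian enters through [flex_parameters]:
    it excludes the curves with j = 0. *)
Lemma hesse_form F O : nonsingular_cubic F -> inflection_point F O ->
  nonsingular_cubic (hessian F) ->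
  exists w A p q, [/\ w ^+ 2 + w + 1 = 0, A \in unitmx, act A O = flex w 0
    & F = pull A (hesse p q)].
Proof.
move=> ns [l /(_ O)[]]; rewrite eqxx => h _ hns.
have hF : F \is 3.-homog by case: ns.
have [B [uB BO h']] := inflection_frame hF h.
have uB' : invmx B \in unitmx by rewrite unitmx_inv.
have ns1 := nonsingular_pull uB ns.
have [a [b [c [d [e [f [g [E1 a0 b0]]]]]]]] := flex_normal_form ns1 h'.
have [M [c' [e' [g' [uM Mpt ecg E2]]]]] := flex_reduced_form c d e f g a0 b0.
have uM' : invmx M \in unitmx by rewrite unitmx_inv.
set F2 := cubic a 0 c' 0 0 e' 0 b 0 g' in E2.
have F2E : F2 = pull (invmx M *m B) F by rewrite -pull_pull E1 E2 pull_invmx.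
have uMB : invmx M *m B \in unitmx by rewrite unitmx_mul uM'.
have ns2 : nonsingular_cubic F2 by rewrite F2E; apply: nonsingular_pull.
have hns2 : nonsingular_cubic (hessian F2).
  rewrite F2E hessian_pull; apply: nonsingularZ; first exact: detA2.
  exact: nonsingular_pull.
have [la [y0 [la0 y00 cE eE gE]]] := flex_parameters b0 ecg ns2 hns2.
have [w w2] := closed_quadratic (- 1) 1 (oner_neq0 K).
have {}w2 : w ^+ 2 + w + 1 = 0 by rewrite -[RHS]w2; ring.
subst c' e' g'.
have [N [p [q [uN Npt E3]]]] := flex_hesse_form b0 la0 y00 w2 ns2.
exists w, (invmx B *m M *m N), p, q.
have uBM : invmx B *m M \in unitmx by rewrite unitmx_mul uB'.
split=> //; first by rewrite unitmx_mul uBM.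
  by rewrite -!act_comp // -BO actK // Mpt.
by rewrite -!pull_pull -E3 -E2 -E1 pull_invmx.
Qed.

End HesseForm.

(** * The harmonic polar of an inflection point *)

Lemma pchar_fieldExt_rat (k : fieldExtType rat) (K : fieldType)
    (iota : {rmorphism k -> K}) : [pchar K] =i pred0.
Proof.
by move=> n; rewrite (fmorph_pchar iota) pchar_lalg Num.Theory.pchar_num.
Qed.

Section HarmonicPolar.
Variable K : fieldType.
Implicit Types (F : {mpoly K[3]}) (P l h : proj2 K).

Definition harmonic_polar F P h : Prop := exists t c,
  [/\ c != 0, polar F P = c *: (lin t * lin h), on (lin t) P & ~ on (lin h) P].

Lemma linv_inj (u v : 'rV[K]_3) : linv u = linv v -> u = v.
Proof. by move=> E; rewrite -(grad_linv u 0) E grad_linv. Qed.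

(** The line t is given by the gradient at P of the polar conic, and h is
    the quotient of the conic by t. *)
Lemma harmonic_polar_uniq F P h h' :
  harmonic_polar F P h -> harmonic_polar F P h' -> h = h'.
Proof.
move=> [t [c [c0 E tP hP]]] [t' [c' [c0' E' tP' hP']]].
have gradE e s g : polar F P = e *: (lin s * lin g) -> on (lin s) P ->
    grad (polar F P) P = (e * (lin g).@[P 0]) *: (s : 'rV_3).
  move=> -> sP; apply/rowP => i; rewrite mxE mderivZ mderivM !mderiv_linv.
  by rewrite mevalZ mevalD !mevalM sP mul0r addr0 mevalC !mxE; ring.
have tt' : t = t'.
  apply: (@proj2P _ _ _ ((c * (lin h).@[P 0])^-1 * (c' * (lin h').@[P 0]))).
  rewrite -scalerA -(gradE _ _ _ E' tP') (gradE _ _ _ E tP) scalerA mulVf ?scale1r //.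
  by rewrite mulf_neq0 //; apply/eqP.
rewrite {}E -{}tt' !scalerAr in E'.
have t0 : lin t != 0.
  apply: contraNneq (proj2_neq0 t) => t0; apply/eqP/linv_inj.
  by rewrite -[linv t]/(lin t) t0 -[0 in RHS](scale0r (t : 'rV_3)) linvZ scale0r.
have /linv_inj hh' : linv (c *: (h : 'rV_3)) = linv (c' *: (h' : 'rV_3)).
  by rewrite !linvZ; apply: (mulfI t0).
by apply: (@proj2P _ _ _ (c^-1 * c')); rewrite -scalerA -hh' scalerA mulVf // scale1r.
Qed.

(** A choice of the harmonic polar, with P as default value. *)
Definition harmonic_polar_of F P : proj2 K := epsilon (inhabits P) (harmonic_polar F P).

Lemma harmonic_polar_ofE F P h : harmonic_polar F P h -> harmonic_polar_of F P = h.
Proof.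
move=> hP; apply: harmonic_polar_uniq (hP).
exact: (epsilon_spec (inhabits P) _ (ex_intro _ h hP)).
Qed.

Lemma map_mpoly_linv (sigma : {rmorphism K -> K}) (v : 'rV[K]_3) :
  map_mpoly sigma (linv v) = linv (map_mx sigma v).
Proof.
rewrite raddf_sum; apply: eq_bigr => i _.
by rewrite /= map_mpolyZ map_mpolyX mxE.
Qed.

Lemma on_map (sigma : {rmorphism K -> K}) F P :
  on (map_mpoly sigma F) (proj2_map sigma P) <-> on F P.
Proof.
have -> : on (map_mpoly sigma F) (proj2_map sigma P) <-> sigma F.@[P 0] = 0.
  rewrite /on -meval_map_mpoly; rewrite (@meval_eq _ _ _ (sigma \o P 0)) // => i.
  by rewrite /= mxE.
by split=> [/eqP|->]; rewrite ?rmorph0 // fmorph_eq0 => /eqP.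
Qed.

Lemma harmonic_polar_map (sigma : {rmorphism K -> K}) F P h : map_mpoly sigma F = F ->
  harmonic_polar F P h -> harmonic_polar F (proj2_map sigma P) (proj2_map sigma h).
Proof.
move=> Fs [t [c [c0 E tP hP]]]; exists (proj2_map sigma t), (sigma c).
have linE l : lin (proj2_map sigma l) = map_mpoly sigma (lin l).
  by rewrite [RHS]map_mpoly_linv.
split; rewrite ?linE ?on_map ?fmorph_eq0 //.
rewrite -rmorphM -map_mpolyZ -E /polar raddf_sum.
by apply: eq_bigr => i _; rewrite /= map_mpolyZ -map_mpoly_mderiv Fs mxE.
Qed.

End HarmonicPolar.

Lemma conj_idxD a b : conj_idx (a + b) = conj_idx a + conj_idx b.
Proof. by rewrite /conj_idx /= opprD. Qed.

Lemma conj_idx0 : conj_idx 0 = 0.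
Proof. by rewrite /conj_idx oppr0. Qed.

Lemma conj_idxK : involutive conj_idx.
Proof. by case=> i j; rewrite /conj_idx /= opprK. Qed.

Lemma symp_conj a b : symp (conj_idx a) (conj_idx b) = - symp a b.
Proof. by rewrite /symp /= mulrN mulNr opprK opprB addrC. Qed.

(** For the Cayleyan the expression 27 p^3 + q^3 becomes 64 (27 p^3 + q^3)^2
    (216 p^3 - q^3), and for the Hessian it becomes 8 (27 p^3 + q^3) (216
    p^3 - q^3)^2. *)
Lemma nonsingular_cay_hesse (K : fieldType) (p q : K) : [pchar K] =i pred0 ->
  nonsingular_cubic (hesse p q) -> nonsingular_cubic (hessian (hesse p q)) ->
  nonsingular_cubic (cay (hesse p q)).
Proof.
move=> char0 /(nonsingular_hesseP char0)[p0 d0].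
rewrite hessian_hesse cay_hesse => /(nonsingular_hesseP char0)[h0 hd].
have q0 : q != 0 by apply: contraNneq h0 => ->; rewrite expr0n mulr0.
have n0 : 216%:R * p ^+ 3 - q ^+ 3 != 0.
  apply: contraNneq hd => E; apply/eqP.
  by apply: (lin_comb1 (c := 8%:R * (27%:R * p ^+ 3 + q ^+ 3)
    * (216%:R * p ^+ 3 - q ^+ 3)) E); ring.
apply/(nonsingular_hesseP char0); split.
  by rewrite !mulf_neq0 ?expf_neq0 // (natK char0 35).
rewrite (_ : _ + _ = 64%:R * (27%:R * p ^+ 3 + q ^+ 3) ^+ 2 * (216%:R * p ^+ 3 - q ^+ 3)).
  by rewrite !mulf_neq0 ?expf_neq0 // (natK char0 63).
by ring.
Qed.

Theorem proposition5p1 (k : fieldExtType rat) (K : closedFieldType)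
    (iota : {rmorphism k -> K}) (Kalg : forall x : K, algebraicOver iota x)
    (F0 : {mpoly k[3]}) (O0 : proj2 k)
    (F := map_mpoly iota F0) (O := proj2_map iota O0)
    (E0_nonsingular : nonsingular_cubic F)
    (O_inflection : inflection_point F O)
    (He_nonsingular : nonsingular_cubic (hessian F)) :
  exists (G0 : {mpoly k[3]}) (phi : proj2 K -> proj2 K),
    let G := map_mpoly iota G0 in
    [/\ cayleyan_equation F G,
        forall P, tors3 F O P ->
          exists2 l, is_eta F P l & is_iota' F O l (phi P),
        torsion_group_iso F O G (phi O) phi,
        galois_equivariant iota (tors3 F O) phi
      & anti_symplectic F O G (phi O) phi].
Proof.
have char0 := pchar_fieldExt_rat iota.
have [w [A [p [q [w2 uA AO FE]]]]] :=
  hesse_form char0 E0_nonsingular O_inflection He_nonsingular.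
pose H := hesse p q; pose D := dual_mx A.
have uD : D \in unitmx := dual_unit uA.
have uA' : invmx A \in unitmx by rewrite unitmx_inv.
have hH : H \is 3.-homog := hesse_homog p q.
have hhH : hessian H \is 3.-homog by rewrite hessian_hesse hesse_homog.
have nsH : nonsingular_cubic H.
  by rewrite -(pull_invmx H uA) -FE; apply: nonsingular_pull.
have nshH : nonsingular_cubic (hessian H).
  by rewrite -(pull_invmx H uA) -FE hessian_pull; apply: nonsingularZ (detA2 uA') _;
    apply: nonsingular_pull.
have [p0 d0] := (nonsingular_hesseP char0 p q).1 nsH.
(* The Cayleyan form is equivalent to a member C of the Hesse pencil of the dual
   plane. *)
pose k4 := \det A ^+ 4.
have k40 : k4 != 0 by rewrite /k4; move: uA; rewrite unitmxE unitfE => /expf_neq0.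
pose p' := k4 * (36%:R * p ^+ 2 * q); pose q' := k4 * (216%:R * p ^+ 3 - 4%:R * q ^+ 3).
pose C := hesse p' q'.
have hC : C \is 3.-homog := hesse_homog p' q'.
have CE : C = k4 *: cay H by rewrite cay_hesse scale_hesse.
have nsC : nonsingular_cubic C.
  by rewrite CE; apply: nonsingularZ k40 _; apply: nonsingular_cay_hesse.
have [p0' d0'] := (nonsingular_hesseP char0 p' q').1 nsC.
pose phi := harmonic_polar_of F.
(* As a polynomial in the coefficients of F0, the Cayleyan form is defined
   over k. *)
exists (cay F0), phi => G.
have GE : G = pull D C.
  by rewrite /G cay_map -/F FE (cay_pull char0 _ uA) CE pullZ.
have torsF P : tors3 F O P <-> exists a, act A P = flex w a.
  by rewrite FE (tors3_pull uA _ _ hH) AO; apply: tors3P.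
have addF a b P Q S : act A P = flex w a -> act A Q = flex w b ->
    add F O P Q S <-> act A S = flex w (a + b).
  move=> Pa Qb; rewrite FE (add_pull uA _ _ _ _ hH) AO Pa Qb.
  exact: (add_flexP char0 w2 p0 d0).
have harm P a : act A P = flex w a ->
    harmonic_polar F P (act (invmx D) (flex w (conj_idx a))).
  move=> Pa; have [c c0 E] := polar_flex char0 w2 q p0 a.
  have [e e0 Ee] : exists2 c, c != 0 & polar F P = c *:
      (lin (act (invmx D) (flex_tangent w p q a)) *
       lin (act (invmx D) (flex w (conj_idx a)))).
    rewrite FE; apply: (polar_lin_pull uA); exists c; first exact: c0.
    rewrite Pa [act (dual_mx A) (act _ (flex_tangent w p q a))](actKV uD).
    by rewrite [act (dual_mx A) (act _ (flex w _))](actKV uD).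
  exists (act (invmx D) (flex_tangent w p q a)), e; split=> //.
    apply/(on_lin_act uA); rewrite (actKV uD) Pa.
    exact: (flex_on_tangent char0 w2 p0 d0).
  move/(on_lin_act uA); rewrite (actKV uD) Pa.
  exact: (flex_not_on_harmonic char0 w2).
have phiE P a : act A P = flex w a -> act D (phi P) = flex w (conj_idx a).
  by move=> Pa; rewrite /phi (harmonic_polar_ofE (harm _ _ Pa)) (actKV uD).
have phiO : act D (phi O) = flex w 0 by rewrite (phiE O 0 AO) conj_idx0.
have torsG R : tors3 G (phi O) R <-> exists a, act D R = flex w a.
  by rewrite GE (tors3_pull uD _ _ hC) phiO; apply: tors3P.
split.
- split; first by rewrite GE; apply: nonsingular_pull.
  move=> l; rewrite GE (on_pull uD _ hC) CE (onZ _ _ k40).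
  by rewrite (cayleyan_hesseP char0 p0 d0) FE (cayleyan_pull uA _ hH hhH).
- move=> P /torsF[a Pa]; exists (act (invmx D) (flex_tangent w p q a)).
    rewrite FE; apply/(is_eta_pull uA _ _ hH hhH); rewrite (actKV uD) Pa.
    exact: is_eta_flex.
  rewrite FE; apply: (is_iota'_pull uA hH hhH); rewrite (actKV uD) AO (phiE _ _ Pa).
  exact: is_iota'_flex.
- split.
  + by move=> P /torsF[a Pa]; apply/torsG; exists (conj_idx a); apply: phiE.
  + move=> P Q /torsF[a Pa] /torsF[b Qb] E; apply: (act_inj uA); rewrite Pa Qb.
    have := phiE _ _ Pa; rewrite E (phiE _ _ Qb) => /(flex_inj char0 w2) ba.
    by rewrite -(conj_idxK a) -ba conj_idxK.
  + move=> R /torsG[a Ra]; have Pa := actKV uA (flex w (conj_idx a)).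
    exists (act (invmx A) (flex w (conj_idx a))).
      by apply/torsF; exists (conj_idx a).
    by apply: (act_inj uD); rewrite (phiE _ _ Pa) conj_idxK.
  + move=> P Q S /torsF[a Pa] /torsF[b Qb] /(addF _ _ _ _ _ Pa Qb) Sab.
    rewrite GE; apply/(add_pull uD _ _ _ _ hC); rewrite phiO (phiE _ _ Pa) (phiE _ _ Qb).
    by apply/(add_flexP char0 w2 p0' d0'); rewrite (phiE _ _ Sab) conj_idxD.
- move=> sigma _ sK P /torsF[a Pa].
  have Fs : map_mpoly sigma F = F.
    by apply/mpolyP => m; rewrite /F !mcoeff_map_mpoly /= sK.
  apply: harmonic_polar_ofE; apply: harmonic_polar_map => //.
  by rewrite /phi (harmonic_polar_ofE (harm _ _ Pa)); apply: harm.
- move=> P Q /torsF[a Pa] /torsF[b Qb]; exists (w ^+ symp a b); split.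
    rewrite FE; apply: (weil3_pull uA hH); rewrite AO Pa Qb.
    exact: weil_hesse.
  have -> : (w ^+ symp a b)^-1 = w ^+ symp (conj_idx a) (conj_idx b).
    have w0 := pow_w_neq0 char0 w2 (symp a b).
    apply: (mulfI w0); rewrite divff // symp_conj -(pow_w_add w2) subrr.
    by [].
  rewrite GE; apply: (weil3_pull uD hC); rewrite phiO (phiE _ _ Pa) (phiE _ _ Qb).
  exact: weil_hesse.
Qed.
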